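(* Let $E$ be a row-finite directed graph. (1) There is a normalised reduced Cuntz-Krieger $E$-family $\{p^m_v : v \in E^0\}$, $\{s^m_e : e \in E^1\}$ which generates $C^*_{\min}(E)$ and satisfies properties (a) and (b) of the context (that is, $(C^*_{\min}(E), p^m, s^m)$ satisfies (a) and (b)). In particular, given any cutting set $X$ for $E$, $C^*_{\min}(E)$ is generated by $\{p^m_v : v \in E^0\} \cup \{s^m_e : e \in E^1 \setminus X\}$. (2) Any other $C^*$-algebra generated by a Toeplitz-Cuntz-Krieger $E$-family satisfying (a) and (b) is isomorphic to $C^*_{\min}(E)$.
   Context: A directed graph $E$ consists of countable sets $E^0$ (vertices) and $E^1$ (edges) and maps $r,s : E^1 \to E^0$; the edge $e$ points from $s(e)$ to $r(e)$. Write $vE^1 = r^{-1}(v)$. $E$ is row-finite if $vE^1$ is finite for every $v \in E^0$. A path is a sequence $\lambda = \lambda_1 \cdots \lambda_n$ of edges with $s(\lambda_i) = r(\lambda_{i+1})$ for $i<n$; $r(\lambda) = r(\lambda_1)$, $s(\lambda) = s(\lambda_n)$, $|\lambda| = n$ (vertices are paths of length $0$). For elements $t_e$ indexed by edges, $t_\lambda := t_{\lambda_1}\cdots t_{\lambda_n}$. A cycle is a path $\mu = \mu_1 \cdots \mu_{|\mu|}$ with $|\mu| \ge 1$, $r(\mu) = s(\mu)$ and $s(\mu_i) \ne s(\mu_j)$ for $i<j$. It has no entrance in $E$ if $e \in E^1$ and $r(e) = r(\mu_i)$ imply $e = \mu_i$, for all $i$. For a cycle $\mu$, $[\mu]$ is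 the set of its cyclic permutations and $[\mu]^1 = \{\mu_i : 1 \le i \le |\mu|\}$. $C(E)$ is the set of all $[\mu]$ where $\mu$ is a cycle with no entrance in $E$, and $C(E)^1 = \bigcup_{C \in C(E)} C^1$. A cutting set for $E$ is a subset $X \subset C(E)^1$ such that $X \cap C^1$ is a singleton for each $C \in C(E)$. A Toeplitz-Cuntz-Krieger $E$-family in a $C^*$-algebra consists of elements $\{p_v : v \in E^0\}$, $\{s_e : e \in E^1\}$ such that (T1) the $p_v$ are mutually orthogonal projections; (T2) $s_e^* s_e = p_{s(e)}$ for all $e \in E^1$; (T3) $p_v \ge \sum_{e \in F} s_e s_e^*$ for all $v \in E^0$ and finite $F \subset r^{-1}(v)$. It is a Cuntz-Krieger $E$-family if moreover (CK) $p_v = \sum_{r(e)=v} s_e s_e^*$ whenever $0 < |r^{-1}(v)| < \infty$. A normalised reduced Cuntz-Krieger $E$-family is a Cuntz-Krieger $E$-family such that $s_\mu = p_{r(\mu)}$ for each cycle $\mu$ with no entrance in $E$. Let $A$ be a $C^*$-algebra generated by a Toeplitz-Cuntz-Krieger $E$-family $\{P_v\}, \{S_e\}$. The properties (a) and (b) are: (a) every $P_v$ is nonzero; (b) given any Toeplitz-Cuntz-Krieger $E$-family $\{q_v\}, \{t_e\}$ in a $C^*$-algebra with each $q_v \ne 0$ and any cutting set $X$ for $E$, there are a function $\kappa : X \to \mathbb{T}$ and a homomorphism $\psi_{q,t} : C^*(\{q_v, t_e : v \in E^0, e \in E^1\}) \to A$ with $\psi_{q,t}(q_v) = P_v$ for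 all $v \in E^0$, $\psi_{q,t}(t_e) = S_e$ for all $e \in E^1 \setminus X$, and $\psi_{q,t}(t_x) = \kappa(x) S_x$ for all $x \in X$. For row-finite $E$ there exists a $C^*$-algebra generated by a Toeplitz-Cuntz-Krieger $E$-family satisfying (a) and (b); $C^*_{\min}(E)$ denotes such a $C^*$-algebra. *)

(* Defs.v *)
From HB Require Import structures.
From mathcomp Require Import all_boot all_order all_algebra.
From mathcomp Require Import all_classical all_reals all_analysis.
From mathcomp.real_closed Require Import complex.

Set Implicit Arguments.
Unset Strict Implicit.
Unset Printing Implicit Defensive.

Import Order.TTheory GRing.Theory Num.Theory.
Import numFieldNormedType.Exports.

Local Open Scope classical_set_scope.
Local Open Scope ring_scope.

(** * C*-algebras *)

(* C*-algebras are not assumed to be unital (the algebra of a graph with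
   infinitely many vertices has no unit), so the product cannot be the one of
   a MathComp ring structure. The norm of a normed R[i]-module takes its
   values in R[i]; these values are nonnegative reals. *)
HB.mixin Record CompleteNormedModule_isCStarAlgebra (R : realType) A
    of CompleteNormedModule R[i] A := {
  cmul : A -> A -> A;
  cadj : A -> A;
  cmulA : forall x y z, cmul x (cmul y z) = cmul (cmul x y) z;
  cmulDl : forall x y z, cmul (x + y) z = cmul x z + cmul y z;
  cmulDr : forall x y z, cmul x (y + z) = cmul x y + cmul x z;
  cmulZl : forall (a : R[i]) x y, cmul (a *: x) y = a *: cmul x y;
  cmulZr : forall (a : R[i]) x y, cmul x (a *: y) = a *: cmul x y;
  cadjK : forall x, cadj (cadj x) = x;
  cadjD : forall x y, cadj (x + y) = cadj x + cadj y;
  cadjZ : forall (a : R[i]) x, cadj (a *: x) = a^* *: cadj x;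
  cadjM : forall x y, cadj (cmul x y) = cmul (cadj y) (cadj x);
  normM_le : forall x y, `|cmul x y| <= `|x| * `|y|;
  cstar_identity : forall x, `|cmul (cadj x) x| = `|x| ^+ 2
}.

#[short(type="cStarAlgType")]
HB.structure Definition CStarAlgebra (R : realType) :=
  {A of CompleteNormedModule R[i] A &
        CompleteNormedModule_isCStarAlgebra R A}.

Notation "x ** y" := (cmul x y) (at level 40, left associativity) : ring_scope.

Section CStarNotions.
Context {R : realType}.
Implicit Types A B : cStarAlgType R.

Definition is_projection A (p : A) := p ** p = p /\ cadj p = p.

Definition cpositive A (x : A) := exists y : A, x = cadj y ** y.

Definition cle A (x y : A) := cpositive (y - x).

Definition cstar_subalgebra A (D : set A) :=
  [/\ closed D,
      D 0 /\ (forall x y, D x -> D y -> D (x + y)),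
      forall (a : R[i]) x, D x -> D (a *: x),
      forall x y, D x -> D y -> D (x ** y) &
      forall x, D x -> D (cadj x)].

(* C*(G) for a subset G of A. *)
Definition cstar_gen A (G : set A) : set A := smallest (@cstar_subalgebra A) G.

Definition cgenerates A (G : set A) := cstar_gen G = setT.

(* Homomorphism from the C*-subalgebra D of B to A; the values of f outside D
   are irrelevant. *)
Definition star_hom_on B A (D : set B) (f : B -> A) :=
  [/\ forall x y, D x -> D y -> f (x + y) = f x + f y,
      forall (a : R[i]) x, D x -> f (a *: x) = a *: f x,
      forall x y, D x -> D y -> f (x ** y) = f x ** f y &
      forall x, D x -> f (cadj x) = cadj (f x)].

Definition cstar_isomorphic B A :=
  exists f : B -> A, star_hom_on setT f /\ bijective f.

End CStarNotions.

(** * Directed graphs *)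

Record digraph := Digraph {
  vertex : countType;
  edge : countType;
  rng : edge -> vertex;
  src : edge -> vertex
}.
Arguments rng {d} e.
Arguments src {d} e.

Section Graphs.
Context (E : digraph).
Implicit Types (mu nu : seq (edge E)) (v : vertex E).

Definition edges_into v : set (edge E) := [set e | rng e = v].

Definition row_finite := forall v, finite_set (edges_into v).

(* Paths of positive length; edges compose as operators do, from right to
   left. *)
Definition is_path mu := sorted (fun e f => src e == rng f) mu.

Definition is_cycle mu :=
  if mu is e :: l then
    [/\ is_path mu, rng e = src (last e l) & uniq (map src mu)]
  else False.

Definition no_entrance mu :=
  forall e f, f \in mu -> rng e = rng f -> e = f.

Definition cycle_class mu : set (seq (edge E)) := [set rot k mu | k in setT].

(* C(E) *)
Definition entryless_classes : set (set (seq (edge E))) :=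
  [set cycle_class mu | mu in [set mu | is_cycle mu /\ no_entrance mu]].

(* C^1; this is the set of edges of mu when C = [mu]. *)
Definition class_edges (C : set (seq (edge E))) : set (edge E) :=
  \bigcup_(mu in C) [set` mu].

(* C(E)^1 *)
Definition entryless_edges : set (edge E) :=
  \bigcup_(C in entryless_classes) class_edges C.

Definition cutting_set (X : set (edge E)) :=
  X `<=` entryless_edges /\
  forall C, entryless_classes C -> exists x, X `&` class_edges C = [set x].

End Graphs.

(** * Cuntz-Krieger families *)

Section Families.
Context {R : realType} (E : digraph).

Section InAlgebra.
Context {A : cStarAlgType R}.
Context (p : vertex E -> A) (s : edge E -> A).

Definition TCK_family :=
  [/\ (forall v, is_projection (p v)) /\
        (forall v w, v <> w -> p v ** p w = 0),
      forall e, cadj (s e) ** s e = p (src e) &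
      forall v (F : set (edge E)), finite_set F -> F `<=` edges_into v ->
        cle (\sum_(e \in F) (s e ** cadj (s e))) (p v)].

Definition CK_family :=
  TCK_family /\
  forall v, edges_into v !=set0 -> finite_set (edges_into v) ->
    p v = \sum_(e \in edges_into v) (s e ** cadj (s e)).

(* s_mu for mu = e l of positive length. *)
Definition path_elt (e : edge E) (l : seq (edge E)) : A :=
  foldl (fun x f => x ** s f) (s e) l.

Definition normalised_reduced_CK_family :=
  CK_family /\
  forall e l, is_cycle (e :: l) -> no_entrance (e :: l) ->
    path_elt e l = p (rng e).

(* The elements p_v together with the s_e for e in Y. *)
Definition family_elts (Y : set (edge E)) : set A := range p `|` s @` Y.

Definition generating_family := cgenerates (family_elts setT).

End InAlgebra.

Definition property_a {A : cStarAlgType R} (P : vertex E -> A) :=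
  forall v, P v <> 0.

Definition property_b {A : cStarAlgType R}
    (P : vertex E -> A) (S : edge E -> A) :=
  forall (B : cStarAlgType R) (q : vertex E -> B) (t : edge E -> B),
  TCK_family q t -> (forall v, q v <> 0) ->
  forall X : set (edge E), cutting_set X ->
  exists (kappa : edge E -> R[i]) (psi : B -> A),
    [/\ forall x, X x -> `|kappa x| = 1,
        star_hom_on (cstar_gen (family_elts q t setT)) psi,
        forall v, psi (q v) = P v,
        forall e, ~ X e -> psi (t e) = S e &
        forall x, X x -> psi (t x) = kappa x *: S x].

Definition satisfies_ab {A : cStarAlgType R}
    (P : vertex E -> A) (S : edge E -> A) :=
  [/\ TCK_family P S, generating_family P S, property_a P & property_b P S].

(* A is a version of the C*-algebra C*_min(E). *)
Definition is_Cstar_min (A : cStarAlgType R) :=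
  exists (P : vertex E -> A) (S : edge E -> A), satisfies_ab P S.

End Families.

(* Main.v *)
Require Import Defs.
From HB Require Import structures.
From mathcomp Require Import all_boot all_order all_algebra.
From mathcomp Require Import all_classical all_reals all_analysis.
From mathcomp Require Import ring lra.
From mathcomp.real_closed Require Import complex.

Set Implicit Arguments.
Unset Strict Implicit.
Unset Printing Implicit Defensive.

Import Order.TTheory GRing.Theory Num.Theory.
Import numFieldNormedType.Exports.

Local Open Scope classical_set_scope.
Local Open Scope ring_scope.

(** The point is that property (b) of a generating family, used
against one good family, transports the relations of that family.

Suppose that some C*-algebra carries a normalised reduced Cuntz-Krieger family
with nonzero projections. Given generators P, S with (a) and (b), fix a cutting
set X and apply (b) to this family: the homomorphism psi sends its projections
to the P_v and its edges t_e to u_e S_e, where u_e = 1 off X and u_x = kappa(x)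
on X. Hence P and u S are the image of a normalised reduced Cuntz-Krieger
family, so they form one themselves (hom_normalised). Multiplying the edges by
scalars of modulus one does not affect (a), (b) or the generated algebra,
because such scalars can be moved to the family against which (b) is tested
(satisfies_ab_phased). This is normalised_generators. If x l is a cycle without
entrance, then s_x s_l = p_{r(x)} and s_l s_l^* = p_{s(x)}, so s_x is the adjoint
of s_l, whose edges lie off any cutting set containing x (cycle_edge). Hence the
edges off a cutting set generate, and between normalised families the scalars
kappa of (b) are 1 (normalised_hom). For two algebras with (a) and (b),
normalised_hom gives homomorphisms both ways that match the generators; they are
mutually inverse because homomorphisms of C*-algebras are continuous.

Two ingredients have to be supplied.

- Continuity (hom_le). It suffices that |f a| <= 1 for a self-adjoint with
  |a| < 1. Banach iteration produces a self-adjoint c commuting with a such that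
  a^2 + (1 - c)^2 = 1. This identity survives f and makes f a + i (1 - f c) and
  f a - i (1 - f c) isometric; f a is half their sum.

- A normalised reduced Cuntz-Krieger family with nonzero projections
  (ck_normalised). Let v have k incoming edges. On the square-summable functions
  on pairs (v, n) of a vertex and a natural number, let the j-th edge e into v
  send the basis vector at (s(e), n) to the one at (v, k n + j). The residue
  classes modulo k give the Cuntz-Krieger relation. A vertex on a cycle without
  entrance has k = 1, so its edge preserves n, and following the whole cycle is
  the identity. To have a C*-algebra around these operators, the adjointable
  bounded operators on a Hilbert space are made into one. *)

(** * Complex scalars and elementary rules of C*-algebras *)

Section ComplexScalars.
Context {R : realType}.

Lemma norm_Re (V : normedZmodType R[i]) (x : V) : `|x| = (complex.Re `|x|)%:C%C.
Proof. by have /ger0_Im := normr_ge0 x; case: `|x| => a b /= ->. Qed.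

Lemma gt0_Re (e : R[i]) : 0 < e -> 0 < complex.Re e /\ e = (complex.Re e)%:C%C.
Proof. by case: e => a b; rewrite ltcE /= => /andP[/eqP-> ->]. Qed.

End ComplexScalars.

Section CStarBasics.
Context {R : realType} {A : cStarAlgType R}.
Implicit Types (x y z : A).

Lemma cmulr0 x : x ** 0 = 0.
Proof. by rewrite -(scale0r (0 : A)) cmulZr !scale0r. Qed.

Lemma cmul0r x : 0 ** x = 0.
Proof. by rewrite -(scale0r (0 : A)) cmulZl !scale0r. Qed.

Lemma cmulrN x y : x ** (- y) = - (x ** y).
Proof. by rewrite -scaleN1r cmulZr scaleN1r. Qed.

Lemma cmulNr x y : (- x) ** y = - (x ** y).
Proof. by rewrite -scaleN1r cmulZl scaleN1r. Qed.

Lemma cmulBr x y z : x ** (y - z) = x ** y - x ** z.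
Proof. by rewrite cmulDr cmulrN. Qed.

Lemma cmulBl x y z : (x - y) ** z = x ** z - y ** z.
Proof. by rewrite cmulDl cmulNr. Qed.

Lemma cadj0 : cadj 0 = 0 :> A.
Proof. by rewrite -(scale0r (0 : A)) cadjZ rmorph0 !scale0r. Qed.

Lemma cadjN x : cadj (- x) = - cadj x.
Proof. by rewrite -scaleN1r cadjZ rmorphN1 scaleN1r. Qed.

Lemma cadjB x y : cadj (x - y) = cadj x - cadj y.
Proof. by rewrite cadjD cadjN. Qed.

Lemma cstar_eq0 x : cadj x ** x = 0 -> x = 0.
Proof.
move=> x0; apply/normr0_eq0/eqP; rewrite -sqrf_eq0.
by rewrite -cstar_identity x0 normr0.
Qed.

Lemma norm_cadj x : `|cadj x| = `|x|.
Proof.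
have le y : `|y| <= `|cadj y|.
  have [->|y0] := eqVneq y 0; first by rewrite cadj0.
  rewrite -(@ler_pM2r _ `|y|) ?normr_gt0// -expr2 -cstar_identity.
  exact: normM_le.
by apply/eqP; rewrite eq_le le andbT -{2}(cadjK x) le.
Qed.

End CStarBasics.

(** * Continuity of homomorphisms *)

Section LipschitzAdditive.
Context {R : realType} {A : normedModType R[i]} {B : normedModType R[i]}.

(** This is the only form of continuity that is used: equations between bounded
additive maps pass to limits and to generated closed subalgebras. *)
Lemma closed_eq0 (F : A -> B) (K : R[i]) :
  {morph F : x y / x - y} -> (forall x, `|F x| <= K * `|x|) ->
  closed [set x | F x = 0].
Proof.
move=> FB FK x clx /=; apply/eqP; apply: contraT => Fx0.
have x0 : x != 0.
  apply: contraNneq Fx0 => ->; rewrite -normr_eq0 eq_le normr_ge0 andbT.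
  by have := FK 0; rewrite normr0 mulr0.
have Fx_gt0 : 0 < `|F x| by rewrite normr_gt0.
have K0 : 0 < K.
  by rewrite -(@pmulr_lgt0 _ `|x|) ?normr_gt0//; exact: lt_le_trans (FK x).
have [y [/= Fy0]] := clx _ (nbhsx_ballx x (`|F x| / K) (divr_gt0 Fx_gt0 K0)).
rewrite -ball_normE /= ltr_pdivlMr// mulrC => /(le_lt_trans (FK _)).
by rewrite FB Fy0 subr0 ltxx.
Qed.

End LipschitzAdditive.

Section GeometricLimit.
Context {R : realType} {X : completeNormedModType R[i]}.

Lemma cvg_geometric_steps (u : nat -> X) (r : R) : 0 <= r < 1 ->
  (forall n, `|u n.+1 - u n| <= (r ^+ n)%:C%C) -> exists l : X, u @ \oo --> l.
Proof.
move=> /andP[r0 r1] ur; suff : cvgn u by move=> ?; exists (limn u).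
have r1' : 0 < 1 - r by rewrite subr_gt0.
have dist n m : `|u (n + m)%N - u n| <= (r ^+ n / (1 - r))%:C%C.
  have : `|u (n + m)%N - u n| <= (r ^+ n * (1 - r ^+ m) / (1 - r))%:C%C.
    elim: m => [|m IH].
      by rewrite addn0 subrr normr0 expr0 subrr mulr0 mul0r.
    rewrite addnS -(subrK (u (n + m)%N) (u _.+1)) -addrA.
    apply: (le_trans (ler_normD _ _)); apply: (le_trans (lerD (ur _) IH)).
    rewrite -rmorphD lecR exprD exprS.
    rewrite -[X in X + _](mulfK (lt0r_neq0 r1')) -mulrDl ler_pM2r ?invr_gt0//.
    rewrite -mulrA -mulrDr ler_wpM2l ?exprn_ge0//.
    by rewrite mulrBr mulr1 [r * _]mulrC addrC addrA subrK.
  move=> /le_trans; apply; rewrite lecR ler_pM2r ?invr_gt0//.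
  by rewrite -[leRHS]mulr1 ler_wpM2l ?exprn_ge0// gerBl exprn_ge0.
apply/cauchy_cvgP; apply: cauchy_exP => e /gt0_Re[e0 ->].
have [N _ HN] : \forall n \near \oo, r ^+ n / (1 - r) < complex.Re e.
  have /cvgrPdist_lt/(_ _ (mulr_gt0 e0 r1')) : (fun n => r ^+ n) @ \oo --> (0 : R).
    by apply: cvg_expr; rewrite ger0_norm.
  apply: filterS => n; rewrite sub0r normrN ger0_norm ?exprn_ge0// => h.
  by rewrite ltr_pdivrMr.
exists (u N); exists N => // n /= Nn; rewrite -ball_normE /= distrC -(subnKC Nn).
by apply: le_lt_trans (dist _ _) _; rewrite ltcR; apply: HN => /=.
Qed.

End GeometricLimit.

Section ContractiveHom.
Context {R : realType}.

(** The element 1 - c is a square root of 1 - a^2; c itself avoids the unit. The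
map c |-> (a^2 + c^2) / 2 preserves the ball of radius |a| and contracts it by
the factor |a| < 1, and its fixed point is c. Its iterates from 0 are
self-adjoint and commute with a, and so does their limit. *)
Lemma exists_circle_partner (A : cStarAlgType R) (a : A) : cadj a = a -> `|a| < 1 ->
  exists c : A, [/\ cadj c = c, c ** a = a ** c & a ** a = c + c - c ** c].
Proof.
move=> asa; rewrite norm_Re; set r := complex.Re _ => r1.
have r0 : 0 <= r by rewrite -ler0c -norm_Re.
rewrite ltcR in r1; pose h : R[i] := 2^-1.
have h0 : 0 <= h by rewrite invr_ge0 ler0n.
pose u := fix u n := if n is n'.+1 then h *: (a ** a + u n' ** u n') else 0.
have hh : h^* = h by apply: geC0_conj.
have aC n : u n ** a = a ** u n.
  elim: n => [|n IH] /=; first by rewrite cmul0r cmulr0.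
  rewrite cmulZl cmulZr cmulDl cmulDr cmulA; congr (_ *: (_ + _)).
  by rewrite -cmulA IH cmulA IH cmulA.
have usa n : cadj (u n) = u n.
  by elim: n => [|n IH] /=; rewrite ?cadj0// cadjZ hh cadjD !cadjM asa IH.
have half2 (x : R[i]) : h * (x + x) = x.
  by rewrite -mulr2n -[x *+ 2]mulr_natl mulrA mulVf ?mul1r// pnatr_eq0.
have ur n : `|u n| <= r%:C%C.
  elim: n => [|n IH] /=; first by rewrite normr0 lecR.
  rewrite normrZ ger0_norm// -(half2 r%:C%C) ler_wpM2l//.
  apply: (le_trans (ler_normD _ _)); apply: lerD.
    rewrite (le_trans (normM_le _ _))// (norm_Re a) -/r -rmorphM lecR.
    by rewrite -[leRHS]mulr1 ler_wpM2l// ltW.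
  rewrite (le_trans (normM_le _ _))// (le_trans (ler_pM _ _ IH IH))//.
  by rewrite -rmorphM lecR -[leRHS]mulr1 ler_wpM2l// ltW.
have sq_lip (x y : A) : `|x| <= r%:C%C -> `|y| <= r%:C%C ->
    `|h *: (x ** x - y ** y)| <= r%:C%C * `|x - y|.
  move=> xr yr; rewrite normrZ ger0_norm// -(half2 (r%:C%C * _)) ler_wpM2l//.
  rewrite -(subrK (x ** y) (x ** x)) -addrA -cmulBr -cmulBl.
  apply: (le_trans (ler_normD _ _)); apply: lerD.
    by rewrite (le_trans (normM_le _ _))// ler_wpM2r.
  by rewrite (le_trans (normM_le _ _))// mulrC ler_wpM2r.
have step n : u n.+2 - u n.+1 = h *: (u n.+1 ** u n.+1 - u n ** u n).
  by rewrite /= -scalerBr opprD addrACA subrr add0r.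
have [c uc] : exists c : A, u @ \oo --> c.
  apply: (@cvg_geometric_steps _ _ _ r); first by rewrite r0 r1.
  elim=> [|n IH].
    rewrite subr0 expr0 (le_trans (ur 1%N))// lecR ltW//.
  rewrite step (le_trans (sq_lip _ _ (ur _) (ur _)))// exprS rmorphM.
  by rewrite ler_wpM2l// lecR.
have inv (F : A -> A) K : {morph F : x y / x - y} ->
    (forall x, `|F x| <= K * `|x|) -> (forall n, F (u n) = 0) -> F c = 0.
  move=> FB FK Fu; have := closed_cvg _ (closed_eq0 FB FK) _ _ uc; apply.
  exact: nearW.
exists c; split.
- apply/eqP; rewrite -subr_eq0; apply/eqP.
  apply: (inv (fun x => cadj x - x) 2) => [x y|x|n].
  + by rewrite cadjB !opprD !opprK addrACA.
  + by rewrite (le_trans (ler_normB _ _))// norm_cadj mulr_natl mulr2n.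
  + by rewrite usa subrr.
- apply/eqP; rewrite -subr_eq0; apply/eqP.
  apply: (inv (fun x => x ** a - a ** x) (`|a| + `|a|)) => [x y|x|n].
  + by rewrite cmulBl cmulBr !opprD !opprK addrACA.
  + rewrite (le_trans (ler_normB _ _))// mulrDl lerD//.
      by rewrite mulrC normM_le.
    exact: normM_le.
  + by rewrite aC subrr.
have cr : `|c| <= r%:C%C.
  apply/ler_addgt0Pr => e e0.
  have [N _ /(_ N (leqnn N))] : \forall n \near \oo, `|c - u n| < e.
    by move/cvgrPdist_lt : uc; apply.
  move=> /ltW ce.
  rewrite -(subrK (u N) c) (le_trans (ler_normD _ _))//.
  by rewrite addrC lerD.
have : c = h *: (a ** a + c ** c).
  apply/eqP; rewrite -subr_eq0 -normr_eq0 eq_le normr_ge0 andbT.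
  apply/ler_addgt0Pr => e e0; rewrite add0r.
  have he0 : 0 < h * e by rewrite mulr_gt0// invr_gt0 ltr0n.
  have [N _ HN] : \forall n \near \oo, `|c - u n| < h * e.
    by move/cvgrPdist_lt : uc; apply.
  rewrite -[X in X - _](subrK (u N.+1) c) -addrA -(half2 e) mulrDr.
  rewrite (le_trans (ler_normD _ _))// lerD//.
    by rewrite ltW//; apply: HN => /=.
  rewrite /= -scalerBr opprD addrACA subrr add0r.
  rewrite (le_trans (sq_lip _ _ (ur _) cr))// distrC.
  rewrite (le_trans (ler_wpM2l _ (ltW (HN N _))))//= ?lecR//.
  by apply: ler_piMl; [exact: ltW|rewrite -[1]/(1%:C)%C lecR ltW].
move=> cE; have h1 : h + h = 1 by rewrite -[h]mulr1 -mulrDr half2.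
have -> : c + c = a ** a + c ** c by rewrite [in LHS]cE -scalerDl h1 scale1r.
by rewrite addrK.
Qed.

(** With y = (1 - d) x, the vectors b x + i y and b x - i y both have the norm of
x: in their squares the cross terms cancel and b^2 + (1 - d)^2 = 1. Multiplying
by x replaces the unit, which need not exist. *)
Lemma norm_le_of_circle (B : cStarAlgType R) (b d x : B) :
  cadj b = b -> cadj d = d -> d ** b = b ** d -> b ** b = d + d - d ** d ->
  `|b ** x| <= `|x|.
Proof.
move=> bsa dsa db bb.
pose y := x - d ** x.
have dbx : d ** (b ** x) = b ** (d ** x) by rewrite cmulA db -cmulA.
have bbx : b ** (b ** x) = d ** x + d ** x - d ** (d ** x).
  by rewrite cmulA bb cmulBl cmulDl cmulA.
have yb : cadj y ** (b ** x) = cadj (b ** x) ** y.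
  by rewrite /y cadjB !cadjM bsa dsa cmulBl cmulBr -!cmulA dbx.
have sum : cadj (b ** x) ** (b ** x) + cadj y ** y = cadj x ** x.
  rewrite /y cadjB !cadjM bsa dsa cmulBl !cmulBr -!cmulA bbx cmulBr cmulDr.
  move: (cadj x ** x) (cadj x ** (d ** x)) (cadj x ** (d ** (d ** x))) => p q m.
  rewrite opprB [p - q + _]addrACA -opprD [LHS]addrC.
  by rewrite [LHS]addrA subrK addrK.
have iso (e : R[i]) : e^* * e = 1 -> e^* = - e -> `|b ** x + e *: y| = `|x|.
  move=> ee eN; apply/eqP; rewrite -(@eqrXn2 _ 2)//; apply/eqP.
  rewrite -!cstar_identity cadjD cadjZ cmulDl !cmulDr !cmulZr !cmulZl scalerA.
  by rewrite [e * _]mulrC ee scale1r yb eN scaleNr addrA addrK sum.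
have ii : 'i^* * 'i = 1 :> R[i] by rewrite conjCi mulNr -expr2 sqrCi opprK.
have := ler_normD (b ** x + 'i *: y) (b ** x + - 'i *: y).
have nii : (- 'i)^* = - - 'i :> R[i] by rewrite rmorphN /= conjCi.
rewrite (iso _ ii (conjCi _)) (iso _ _ nii); last by rewrite rmorphN mulrNN.
rewrite scaleNr addrACA subrr addr0 -!mulr2n normrMn.
by rewrite lerMn2r.
Qed.

(** On the open unit ball norm_le_of_circle, applied to x = f z, bounds
|f z|^2 = |f z f z| by |f z|. Rescaling by a number strictly between |a| and
|f a| turns a failure of the general bound into one on the ball. *)
Lemma hom_le_sa (A B : cStarAlgType R) (f : A -> B) (a : A) :
  star_hom_on setT f -> cadj a = a -> `|f a| <= `|a|.
Proof.
case=> fD fZ fM fV asa.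
have fsa z : cadj z = z -> cadj (f z) = f z by move=> {2}<-; rewrite fV.
have fN z : f (- z) = - f z by rewrite -scaleN1r fZ// scaleN1r.
have unit z : cadj z = z -> `|z| < 1 -> `|f z| <= 1.
  move=> zsa /(exists_circle_partner zsa)[c [csa cz zz]].
  have [->|fz0] := eqVneq (f z) 0; first by rewrite normr0.
  rewrite -(@ler_pM2r _ `|f z|) ?normr_gt0// mul1r -expr2 -cstar_identity.
  rewrite fsa//; apply: (@norm_le_of_circle _ _ (f c)) => //.
  - exact: fsa.
  - exact: fsa.
  - by rewrite -!fM// cz.
  - by rewrite -!fM// zz !fD// fN.
rewrite real_leNgt ?normr_real//; apply/negP => /midf_lt[].
set r := _ / _ => ar rfa.
have r0 : 0 < r := le_lt_trans (normr_ge0 a) ar.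
have rr : r^-1^* = r^-1 by apply: geC0_conj; rewrite invr_ge0 ltW.
have := unit (r^-1 *: a); rewrite cadjZ rr asa fZ// !normrZ.
rewrite ger0_norm ?invr_ge0 ?(ltW r0)// ler_pdivrMl// ltr_pdivrMl// mulr1 => /(_ erefl ar).
by move=> /(lt_le_trans rfa); rewrite ltxx.
Qed.

(** The C*-identity reduces the bound to the self-adjoint element a^* a. *)
Lemma hom_le (A B : cStarAlgType R) (f : A -> B) (a : A) :
  star_hom_on setT f -> `|f a| <= `|a|.
Proof.
move=> fh; rewrite -(@ler_pXn2r _ 2) ?nnegrE ?normr_ge0//.
have [_ _ fM fV] := fh; rewrite -!cstar_identity -fV// -fM//.
by apply: hom_le_sa; rewrite // cadjM cadjK.
Qed.

End ContractiveHom.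

(** * The C*-algebra of operators on a Hilbert space *)

(** The form ip is the real part of the usual complex inner product, which
determines it; a real form is easier to build by polarisation. Completeness is
stated with filters, as in the definition of complete normed modules, so that a
Cauchy filter of operators can be evaluated at each vector. *)
Record hilbert (R : realType) := Hilbert {
  hsort :> lmodType R[i];
  ip : hsort -> hsort -> R;
  ipC : forall x y, ip x y = ip y x;
  ipDl : forall x y z, ip (x + y) z = ip x z + ip y z;
  ipZr : forall (r : R) x y, ip (r%:C%C *: x) y = r * ip x y;
  ipZ : forall (a : R[i]) x y, ip (a *: x) y = ip x (a^* *: y);
  ip_ge0 : forall x, 0 <= ip x x;
  ip_eq0 : forall x, ip x x = 0 -> x = 0;
  ip_complete : forall F : set_system hsort, ProperFilter F ->
    (forall e : R, 0 < e ->
       exists x, F [set y | Num.sqrt (ip (y - x) (y - x)) <= e]) ->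
    exists x, forall e : R, 0 < e ->
       F [set y | Num.sqrt (ip (y - x) (y - x)) <= e]
}.

Section HilbertTheory.
Context {R : realType} {H : hilbert R}.
Implicit Types (x y z : H) (T : H -> H).

Definition hnorm x : R := Num.sqrt (ip x x).

Lemma ipDr x y z : ip x (y + z) = ip x y + ip x z.
Proof. by rewrite ipC ipDl !(ipC x). Qed.

Lemma ipNl x y : ip (- x) y = - ip x y.
Proof.
have N1 : (-1)%:C%C = -1 :> R[i] by rewrite rmorphN1.
by rewrite -scaleN1r -N1 ipZr mulN1r.
Qed.

Lemma ipNr x y : ip x (- y) = - ip x y.
Proof. by rewrite ipC ipNl ipC. Qed.

Lemma ipBl x y z : ip (x - y) z = ip x z - ip y z.
Proof. by rewrite ipDl ipNl. Qed.

Lemma ipBr x y z : ip x (y - z) = ip x y - ip x z.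
Proof. by rewrite ipDr ipNr. Qed.

Lemma ip0l x : ip 0 x = 0.
Proof. by rewrite -(subrr (0 : H)) ipBl subrr. Qed.

Lemma ip_inj x y : (forall z, ip x z = ip y z) -> x = y.
Proof.
move=> xy; apply/eqP; rewrite -subr_eq0; apply/eqP/ip_eq0.
by rewrite ipBl xy subrr.
Qed.

Lemma hnorm_ge0 x : 0 <= hnorm x. Proof. exact: sqrtr_ge0. Qed.

Lemma sqr_hnorm x : hnorm x ^+ 2 = ip x x.
Proof. by rewrite sqr_sqrtr// ip_ge0. Qed.

Lemma hnorm_eq0 x : hnorm x = 0 -> x = 0.
Proof. by move=> x0; apply: ip_eq0; rewrite -sqr_hnorm x0 expr0n. Qed.

Lemma hnorm0 : hnorm 0 = 0.
Proof. by rewrite /hnorm ip0l sqrtr0. Qed.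

(** Cauchy-Schwarz inequality: the square of hnorm y x - hnorm x y is
nonnegative. *)
Lemma ip_le x y : ip x y <= hnorm x * hnorm y.
Proof.
have [/hnorm_eq0 ->|x0] := eqVneq (hnorm x) 0.
  by rewrite hnorm0 mul0r ip0l.
have [/hnorm_eq0 ->|y0] := eqVneq (hnorm y) 0.
  by rewrite hnorm0 mulr0 ipC ip0l.
have xy : 0 < hnorm x * hnorm y by rewrite mulr_gt0// lt0r ?x0 ?y0 hnorm_ge0.
have := ip_ge0 ((hnorm y)%:C%C *: x - (hnorm x)%:C%C *: y).
rewrite ipBl !ipBr !ipZr !(ipC _ (_ *: _)) !ipZr (ipC y x) -!sqr_hnorm => h.
rewrite -(ler_pM2l xy); move: h; set a := hnorm x; set b := hnorm y; lra.
Qed.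

Lemma ip_norm_le x y : `|ip x y| <= hnorm x * hnorm y.
Proof.
rewrite ler_norml ip_le andbT lerNl -ipNl (le_trans (ip_le _ _))//.
by rewrite /hnorm ipNl ipNr opprK.
Qed.

Lemma hnormN x : hnorm (- x) = hnorm x.
Proof. by rewrite /hnorm ipNl ipNr opprK. Qed.

Lemma hnormD x y : hnorm (x + y) <= hnorm x + hnorm y.
Proof.
rewrite -(@ler_pXn2r _ 2) ?nnegrE ?addr_ge0 ?hnorm_ge0// sqr_hnorm sqrrD.
rewrite ipDl !ipDr (ipC y x) -!sqr_hnorm; have := ip_le x y; lra.
Qed.

Lemma hnormB x y : hnorm (x - y) = hnorm (y - x).
Proof. by rewrite -opprB hnormN. Qed.

Lemma hnormZ (a : R[i]) x : hnorm (a *: x) = complex.Re `|a| * hnorm x.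
Proof.
rewrite -[RHS]ger0_norm; last by rewrite mulr_ge0 ?hnorm_ge0// -ler0c -norm_Re.
rewrite -sqrtr_sqr exprMn sqr_hnorm; congr Num.sqrt.
rewrite ipZ scalerA ipC -ipZr; congr (ip (_ *: _) _).
by rewrite mulrC -normCK [in LHS]norm_Re rmorphXn.
Qed.

(** Estimates on a pointwise limit are obtained with x a difference from the
limit and y the error of an approximant, which depends on e. *)
Lemma hnorm_le_eps x (K : R) :
  (forall e, 0 < e -> exists y, hnorm y <= e /\ hnorm (x + y) <= K) ->
  hnorm x <= K.
Proof.
move=> h; apply/ler_addgt0Pr => e /h[y [ye xyK]].
rewrite -(addrK y x) (le_trans (hnormD _ _))// hnormN lerD//.
Qed.

Definition adjoint_pair (T T' : H -> H) := forall x y, ip (T x) y = ip x (T' y).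

Definition homogeneous T := forall (a : R[i]) x, T (a *: x) = a *: T x.

Definition hbounded T :=
  exists M : R, 0 <= M /\ forall x, hnorm (T x) <= M * hnorm x.

(** Complex homogeneity is part of the definition because adjunction for the real
form only implies real linearity. *)
Definition adjointable T :=
  [/\ homogeneous T, exists T', adjoint_pair T T' & hbounded T].

(** Having an adjoint forces additivity, since the form separates vectors. *)
Lemma adjoint_pairD T T' x y : adjoint_pair T T' -> T (x + y) = T x + T y.
Proof. by move=> TT'; apply: ip_inj => z; rewrite TT' !ipDl !TT'. Qed.

Lemma adjoint_pairC T T' : adjoint_pair T T' -> adjoint_pair T' T.
Proof. by move=> TT' x y; rewrite ipC -TT' ipC. Qed.

(** The bound on T' is that of T: |T' y|^2 = <T T' y, y> <= M |T' y| |y|. *)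
Lemma adjointable_adj T T' : adjointable T -> adjoint_pair T T' ->
  adjointable T'.
Proof.
move=> [Th _ [M [M0 TM]]] TT'; split.
- move=> a y; apply: ip_inj => x; rewrite ![ip _ x]ipC -TT'.
  by rewrite ![ip _ (a *: _)]ipC !ipZ ![ip _ (_^* *: _)]ipC -Th TT' ipC.
- by exists T; exact: adjoint_pairC.
- exists M; split=> // y; have [/eqP|y0] := eqVneq (hnorm (T' y)) 0.
    by move=> /eqP ->; rewrite mulr_ge0 ?hnorm_ge0.
  have T'y : 0 < hnorm (T' y) by rewrite lt0r y0 hnorm_ge0.
  rewrite -(ler_pM2l T'y) -expr2 sqr_hnorm -TT' (le_trans (ip_le _ _))//.
  by rewrite mulrCA mulrA ler_wpM2r ?hnorm_ge0.
Qed.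

(** The algebra is a submodule of all functions from H to H rather than of pairs
of adjoint functions: scalars act on the second component of such a pair by
their conjugates. *)
Definition adjointable_pred : {pred (H -> H)} := fun T => `[< adjointable T >].

Fact adjointable_submod : submod_closed adjointable_pred.
Proof.
split=> [|a T S /asboolP[Th [T' TT'] [M [M0 TM]]] /asboolP[Sh [S' SS'] [N [N0 SN]]]].
  apply/asboolP; split.
  - by move=> a x; rewrite [RHS](scaler0 _ a).
  - by exists (fun=> 0) => x y; rewrite [LHS](ip0l y) ipC ip0l.
  - by exists 0; split=> // x; rewrite hnorm0 mul0r.
apply/asboolP; split.
- move=> b x; rewrite /= !fctE /= Th Sh scalerDr !scalerA.
  by rewrite mulrC.
- exists (fun y => a^* *: T' y + S' y) => x y.
  by rewrite !fctE ipDl ipDr SS' -Th TT' ipZ.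
- exists (complex.Re `|a| * M + N).
  have a0 : 0 <= complex.Re `|a| by rewrite -ler0c -norm_Re.
  split=> [|x]; first by rewrite addr_ge0// mulr_ge0.
  rewrite !fctE (le_trans (hnormD _ _))// mulrDl lerD// hnormZ -mulrA.
  by rewrite ler_wpM2l.
Qed.

HB.instance Definition _ := GRing.isSubmodClosed.Build R[i] (H -> H)
  adjointable_pred adjointable_submod.

End HilbertTheory.

Section Operators.
Context {R : realType} (H : hilbert R).

Record adjop := AdjOp { op :> H -> H; opP : op \in (@adjointable_pred R H) }.

HB.instance Definition _ := [isSub for op].
HB.instance Definition _ := [Choice of adjop by <:].
HB.instance Definition _ := [SubChoice_isSubLmodule of adjop by <:].

End Operators.

Section OperatorNorm.
Context {R : realType} {H : hilbert R}.
Implicit Types (T S : adjop H) (x y : H).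

Lemma op_ext T S : (forall x, T x = S x) -> T = S.
Proof. by move=> TS; apply/val_inj/funext. Qed.

Lemma opDE T S x : (T + S) x = T x + S x. Proof. by []. Qed.
Lemma opBE T S x : (T - S) x = T x - S x. Proof. by []. Qed.
Lemma opZE (a : R[i]) T x : (a *: T) x = a *: T x. Proof. by []. Qed.

Lemma op_adjointable T : adjointable T. Proof. exact/asboolP/(opP T). Qed.

Lemma op_scale T (a : R[i]) x : T (a *: x) = a *: T x.
Proof. by have [+ _ _] := op_adjointable T. Qed.

Lemma op_add T x y : T (x + y) = T x + T y.
Proof. by have [_ [T' TT'] _] := op_adjointable T; exact: adjoint_pairD TT'. Qed.

Lemma op_zero T : T 0 = 0.
Proof. by rewrite -(scale0r (0 : H)) op_scale !scale0r. Qed.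

(** The ratio is 0 at the zero vector, by the convention on 1 / 0, so the supremum
ranges over all vectors and is never over the empty set. *)
Definition hratio T : set R := [set hnorm (T x) / hnorm x | x in setT].

Definition opnorm T : R := sup (hratio T).

Lemma hratio_le T (M : R) : 0 <= M -> (forall x, hnorm (T x) <= M * hnorm x) ->
  ubound (hratio T) M.
Proof.
move=> M0 TM _ [x _ <-]; have [->|x0] := eqVneq (hnorm x) 0.
  by rewrite invr0 mulr0.
by rewrite ler_pdivrMr ?TM// lt0r x0 hnorm_ge0.
Qed.

Lemma hratio_has_sup T : has_sup (hratio T).
Proof.
have [_ _ [M [M0 TM]]] := op_adjointable T.
by split; [exists (hnorm (T 0) / hnorm (0 : H)), 0|exists M; exact: hratio_le].
Qed.

Lemma opnorm_ge0 T : 0 <= opnorm T.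
Proof.
apply: sup_ubound; first by have [] := hratio_has_sup T.
by exists 0 => //; rewrite hnorm0 invr0 mulr0.
Qed.

Lemma opnormP T x : hnorm (T x) <= opnorm T * hnorm x.
Proof.
have [/hnorm_eq0 ->|x0] := eqVneq (hnorm x) 0.
  by rewrite op_zero hnorm0 mulr0.
rewrite -ler_pdivrMr ?lt0r ?x0 ?hnorm_ge0//.
by apply: sup_ubound; [have [] := hratio_has_sup T|exists x].
Qed.

Lemma opnorm_le T (M : R) : 0 <= M -> (forall x, hnorm (T x) <= M * hnorm x) ->
  opnorm T <= M.
Proof.
move=> M0 TM; apply: ge_sup; first by have [] := hratio_has_sup T.
exact: hratio_le.
Qed.

Definition opnormC T : R[i] := (opnorm T)%:C%C.

Fact opnormCD T S : opnormC (T + S) <= opnormC T + opnormC S.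
Proof.
rewrite -rmorphD lecR; apply: opnorm_le => [|x].
  by rewrite addr_ge0 ?opnorm_ge0.
by rewrite opDE (le_trans (hnormD _ _))// mulrDl lerD// opnormP.
Qed.

Fact opnormC_eq0 T : opnormC T = 0 -> T = 0.
Proof.
move=> [T0]; apply: op_ext => x; apply/hnorm_eq0/eqP.
by rewrite eq_le hnorm_ge0 andbT (le_trans (opnormP _ _))// T0 mul0r.
Qed.

Lemma opnormZ_le (a : R[i]) T : opnorm (a *: T) <= complex.Re `|a| * opnorm T.
Proof.
have a0 : 0 <= complex.Re `|a| by rewrite -ler0c -norm_Re.
apply: opnorm_le => [|x]; first by rewrite mulr_ge0 ?opnorm_ge0.
by rewrite opZE hnormZ -mulrA ler_wpM2l// opnormP.
Qed.

Fact opnormCZ (a : R[i]) T : opnormC (a *: T) = `|a| * opnormC T.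
Proof.
have le b S : opnormC (b *: S) <= `|b| * opnormC S.
  by rewrite [X in X * _]norm_Re -rmorphM lecR opnormZ_le.
apply/eqP; rewrite eq_le le/=.
have [->|a0] := eqVneq a 0.
  by rewrite normr0 mul0r lecR opnorm_ge0.
have {1}-> : T = a^-1 *: (a *: T) by rewrite scalerA mulVf// scale1r.
rewrite -ler_pdivlMl ?normr_gt0// -normfV.
exact: le.
Qed.

HB.instance Definition _ := Lmodule_isNormed.Build R[i] (adjop H)
  opnormCD opnormCZ opnormC_eq0.

Lemma norm_opE T : `|T| = (opnorm T)%:C%C. Proof. by []. Qed.

Lemma adj_ex T : exists T' : adjop H, adjoint_pair T T'.
Proof.
have := op_adjointable T; have [_ [T' TT'] _] := op_adjointable T => Ta.
by exists (AdjOp (introT (asboolP _) (adjointable_adj Ta TT'))).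
Qed.

Definition adj T : adjop H := projT1 (cid (adj_ex T)).

Lemma adjE T x y : ip (T x) y = ip x (adj T y).
Proof. exact: (projT2 (cid (adj_ex T))). Qed.

Lemma adj_unique T S : adjoint_pair T S -> adj T = S.
Proof.
move=> TS; apply: op_ext => y; apply: ip_inj => x.
by rewrite ipC -adjE TS ipC.
Qed.

Lemma adjK T : adj (adj T) = T.
Proof. by apply: adj_unique; apply: adjoint_pairC => x y; rewrite adjE. Qed.

Lemma adjD T S : adj (T + S) = adj T + adj S.
Proof.
by apply: adj_unique => x y; rewrite !opDE ipDl ipDr !adjE.
Qed.

Lemma adjZ (a : R[i]) T : adj (a *: T) = a^* *: adj T.
Proof.
by apply: adj_unique => x y; rewrite !opZE ipZ adjE op_scale.
Qed.

Fact comp_adjointable T S : (op T \o op S) \in (@adjointable_pred R H).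
Proof.
apply/asboolP; split.
- by move=> a x; rewrite /= !op_scale.
- by exists (op (adj S) \o op (adj T)) => x y; rewrite /= !adjE.
- exists (opnorm T * opnorm S); split=> [|x]; first by rewrite mulr_ge0 ?opnorm_ge0.
  rewrite /= (le_trans (opnormP _ _))// -mulrA ler_wpM2l ?opnorm_ge0//.
  exact: opnormP.
Qed.

Definition opcomp T S : adjop H := AdjOp (comp_adjointable T S).

Lemma adj_comp T S : adj (opcomp T S) = opcomp (adj S) (adj T).
Proof. by apply: adj_unique => x y; rewrite /= !adjE. Qed.

Fact norm_comp_le T S : `|opcomp T S| <= `|T| * `|S|.
Proof.
rewrite -rmorphM lecR; apply: opnorm_le => [|x].
  by rewrite mulr_ge0 ?opnorm_ge0.
rewrite /= (le_trans (opnormP _ _))// -mulrA ler_wpM2l ?opnorm_ge0//.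
exact: opnormP.
Qed.

(** The nontrivial half of the C*-identity: |T x|^2 = <x, T^* T x>. *)
Lemma sqr_opnorm_le T : opnorm T ^+ 2 <= opnorm (opcomp (adj T) T).
Proof.
have K0 := opnorm_ge0 (opcomp (adj T) T).
rewrite -[leRHS](sqr_sqrtr K0) ler_pXn2r ?nnegrE ?opnorm_ge0 ?sqrtr_ge0//.
apply: opnorm_le => [|x]; first exact: sqrtr_ge0.
rewrite -(@ler_pXn2r _ 2) ?nnegrE ?mulr_ge0 ?hnorm_ge0 ?sqrtr_ge0//.
rewrite exprMn (sqr_sqrtr K0) sqr_hnorm adjE (le_trans (ip_le _ _))//.
by rewrite mulrC expr2 mulrA ler_wpM2r ?hnorm_ge0// (opnormP (opcomp (adj T) T)).
Qed.

Lemma opnorm_adj T : opnorm (adj T) = opnorm T.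
Proof.
have le S : opnorm S <= opnorm (adj S).
  have [->|S0] := eqVneq (opnorm S) 0; first exact: opnorm_ge0.
  have Sp : 0 < opnorm S by rewrite lt0r S0 opnorm_ge0.
  rewrite -(ler_pM2r Sp) -expr2 (le_trans (sqr_opnorm_le _))//.
  by have := norm_comp_le (adj S) S; rewrite -rmorphM lecR.
by apply/eqP; rewrite eq_le le andbT -{2}(adjK T) le.
Qed.

Fact cstar_id T : `|opcomp (adj T) T| = `|T| ^+ 2.
Proof.
apply/eqP; rewrite eq_le; apply/andP; split.
  by rewrite (le_trans (norm_comp_le _ _))// !norm_opE opnorm_adj expr2.
by rewrite !norm_opE -rmorphXn lecR sqr_opnorm_le.
Qed.

End OperatorNorm.

(** A Cauchy filter of operators converges pointwise, and so does its image under
adjunction; the pointwise limits are adjoint to each other and the convergence is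
uniform. *)
Section OperatorComplete.
Context {R : realType} {H : hilbert R}.
Implicit Types (T S : adjop H) (x y : H).

Lemma opnorm_ball T S (e : R) : ball T (e%:C%C) S -> opnorm (S - T) < e.
Proof. by rewrite -ball_normE/= distrC norm_opE ltcR. Qed.

Section Limit.
Variable F : set_system (adjop H).
Hypotheses (FF : ProperFilter F) (Fc : cauchy F).

Lemma cauchy_opnorm (e : R) : 0 < e -> exists T, F [set S | opnorm (S - T) < e].
Proof.
move=> e0; have e0' : 0 < e%:C%C by rewrite ltcR.
have [T FT] := ((cauchyP F).1 Fc) _ e0'.
by exists T; apply: filterS FT => S; exact: opnorm_ball.
Qed.

Lemma op_limit_ex (phi : adjop H -> H) (K : R) : 0 <= K ->
  (forall T S, hnorm (phi S - phi T) <= K * opnorm (S - T)) ->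
  exists l, forall e : R, 0 < e -> F [set T | hnorm (phi T - l) <= e].
Proof.
move=> K0 phiK; have [e e0|l Fl] := @ip_complete _ H (phi @ F) _.
  have K1 : 0 < K + 1 by rewrite ltr_wpDl.
  have [T FT] := cauchy_opnorm (divr_gt0 e0 K1).
  exists (phi T); apply: (@filterS _ F _ _ (phi @^-1` _) _ FT) => S /ltW ST /=.
  apply: (le_trans (phiK T S)).
  rewrite (le_trans (ler_wpM2r (opnorm_ge0 _) (_ : K <= K + 1)))// ?lerDl//.
  by rewrite mulrC -ler_pdivlMr.
by exists l.
Qed.

Lemma op_lim_ex x : exists l, forall e : R, 0 < e ->
  F [set T | hnorm (T x - l) <= e].
Proof.
apply: (op_limit_ex (hnorm_ge0 x)) => T S.
by rewrite -opBE mulrC opnormP.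
Qed.

Lemma adj_lim_ex x : exists l, forall e : R, 0 < e ->
  F [set T | hnorm (adj T x - l) <= e].
Proof.
apply: (op_limit_ex (hnorm_ge0 x)) => T S.
have -> : adj S x - adj T x = adj (S - T) x.
  rewrite -[in RHS](scaleN1r T) adjD adjZ rmorphN1.
  by rewrite opDE opZE scaleN1r.
by rewrite -opnorm_adj mulrC opnormP.
Qed.

Let L x : H := projT1 (cid (op_lim_ex x)).
Let L' x : H := projT1 (cid (adj_lim_ex x)).

Let LP x (e : R) : 0 < e -> F [set T | hnorm (T x - L x) <= e].
Proof. exact: (projT2 (cid (op_lim_ex x))). Qed.

Let L'P x (e : R) : 0 < e -> F [set T | hnorm (adj T x - L' x) <= e].
Proof. exact: (projT2 (cid (adj_lim_ex x))). Qed.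

Let L_adjoint : adjoint_pair L L'.
Proof.
move=> x y; apply/eqP; rewrite -subr_eq0 -normr_eq0 eq_le normr_ge0 andbT.
apply/ler_addgt0Pr => e e0; rewrite add0r.
have K0 : 0 < hnorm x + hnorm y + 1 by rewrite ltr_wpDl// addr_ge0 ?hnorm_ge0.
have d0 := divr_gt0 e0 K0.
have [T [/= TL TL']] := filter_ex (filterI (LP x d0) (L'P y d0)).
have -> : ip (L x) y - ip x (L' y) =
    ip x (adj T y - L' y) - ip (T x - L x) y.
  by rewrite ipBl ipBr -adjE; ring.
rewrite (le_trans (ler_normB _ _))//.
have := ip_norm_le x (adj T y - L' y); have := ip_norm_le (T x - L x) y.
have := ler_wpM2r (hnorm_ge0 y) TL; have := ler_wpM2l (hnorm_ge0 x) TL'.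
have : (hnorm x + hnorm y + 1) * (e / (hnorm x + hnorm y + 1)) = e.
  by rewrite mulrC divfK// lt0r_neq0.
set d := e / _ in d0 *; nra.
Qed.

Let L_close T (e : R) : 0 <= e -> F [set S | opnorm (S - T) < e] ->
  forall x, hnorm (L x - T x) <= e * hnorm x.
Proof.
move=> e0 FT x; apply: hnorm_le_eps => d d0.
have [S [/= SL ST]] := filter_ex (filterI (LP x d0) FT).
exists (S x - L x); split=> //; rewrite [_ + (S x - L x)]addrC addrA subrK -opBE.
by rewrite (le_trans (opnormP _ _))// ler_wpM2r ?hnorm_ge0// ltW.
Qed.

Let L_adjointable : L \in (@adjointable_pred R H).
Proof.
apply/asboolP; split.
- move=> a x; apply/eqP; rewrite -subr_eq0.
  apply/eqP/hnorm_eq0/eqP; rewrite eq_le hnorm_ge0 andbT.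
  apply: hnorm_le_eps => e e0.
  have a0 : 0 <= complex.Re `|a| by rewrite -ler0c -norm_Re.
  have a1 : 0 < 1 + complex.Re `|a| by rewrite ltr_pwDl.
  have d0 := divr_gt0 e0 a1.
  have [T [/= T1 T2]] := filter_ex (filterI (LP (a *: x) d0) (LP x d0)).
  (* Since T is homogeneous, its distance to L cancels the defect of L. *)
  exists ((T (a *: x) - L (a *: x)) - a *: (T x - L x)); split.
    rewrite (le_trans (hnormD _ _))// hnormN hnormZ.
    rewrite (le_trans (lerD T1 (ler_wpM2l a0 T2)))//.
    by rewrite -{1}[e / _]mul1r -mulrDl mulrC divfK// lt0r_neq0.
  have key (p q t : H) : p - q + (t - p - (t - q)) = 0.
    by rewrite opprB (addrC (t - p)) [q - t + _]addrA subrK addrA subrK subrr.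
  by rewrite op_scale scalerBr key hnorm0.
- by exists L'.
- have [T FT] := cauchy_opnorm ltr01.
  exists (1 + opnorm T); split=> [|x]; first by rewrite addr_ge0 ?opnorm_ge0.
  rewrite -(subrK (T x) (L x)) (le_trans (hnormD _ _))// mulrDl lerD//.
    exact: L_close.
  exact: opnormP.
Qed.

Lemma op_cauchy_cvg : cvg F.
Proof.
apply/cvg_ex; exists (AdjOp L_adjointable).
apply/cvgrPdist_lt => eps /gt0_Re[]; set e := complex.Re _ => e0 ->.
have e4 : 0 < e / 4 by rewrite divr_gt0.
have [T FT] := cauchy_opnorm e4.
apply: filterS (FT) => S ST; rewrite norm_opE ltcR.
have SL : opnorm (AdjOp L_adjointable - S) <= e / 2.
  apply: opnorm_le => [|x]; first by rewrite divr_ge0 ?ltW.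
  rewrite opBE -(subrK (T x) (AdjOp _ x)) -addrA (le_trans (hnormD _ _))//.
  have := L_close (ltW e4) FT x.
  rewrite [hnorm (T x - S x)]hnormB -opBE; have := opnormP (S - T) x.
  have := ler_wpM2r (hnorm_ge0 x) (ltW ST); rewrite /=; lra.
by rewrite (le_lt_trans SL)// ltr_pdivrMr// ltr_pMr// ltr1n.
Qed.

End Limit.

HB.instance Definition _ := Uniform_isComplete.Build (adjop H) op_cauchy_cvg.

Fact opcompA T S U : opcomp T (opcomp S U) = opcomp (opcomp T S) U.
Proof. exact: op_ext. Qed.

Fact opcompDl T S U : opcomp (T + S) U = opcomp T U + opcomp S U.
Proof. exact: op_ext. Qed.

Fact opcompDr T S U : opcomp T (S + U) = opcomp T S + opcomp T U.
Proof. by apply: op_ext => x; rewrite /= op_add. Qed.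

Fact opcompZl (a : R[i]) T S : opcomp (a *: T) S = a *: opcomp T S.
Proof. exact: op_ext. Qed.

Fact opcompZr (a : R[i]) T S : opcomp T (a *: S) = a *: opcomp T S.
Proof. by apply: op_ext => x; rewrite /= op_scale. Qed.

HB.instance Definition _ := CompleteNormedModule_isCStarAlgebra.Build R
  (adjop H) opcompA opcompDl opcompDr opcompZl opcompZr
  (@adjK R H) (@adjD R H) (@adjZ R H) (@adj_comp R H)
  (@norm_comp_le R H) (@cstar_id R H).

End OperatorComplete.

(** * Square-summable functions *)

Section UnorderedSums.
Context {R : realType} {I : choiceType}.
Implicit Types (f g : I -> R) (s : seq I).

Lemma ler_sum_subset f s t : (forall i, 0 <= f i) -> uniq s -> uniq t ->
  {subset s <= t} -> \sum_(i <- s) f i <= \sum_(i <- t) f i.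
Proof.
move=> f0 us ut st; rewrite [leRHS](bigID (mem s))/=.
have /(perm_big _)-> : perm_eq s [seq i <- t | i \in s].
  apply: uniq_perm; rewrite ?filter_uniq// => i; rewrite mem_filter.
  by apply/idP/andP => [is_|[]//]; split=> //; exact: st.
by rewrite big_filter lerDl sumr_ge0.
Qed.

(** Sums of nonnegative families are suprema of finite partial sums, taken over
duplicate-free sequences; unlike ordered series, they can be reindexed freely. *)
Definition psums f : set R := [set \sum_(i <- s) f i | s in [set s | uniq s]].

Definition tsum f : R := sup (psums f).

Definition nnsummable f := (forall i, 0 <= f i) /\ has_ubound (psums f).

Lemma nnsummableP f (M : R) : (forall i, 0 <= f i) ->
  (forall s, uniq s -> \sum_(i <- s) f i <= M) -> nnsummable f.
Proof. by move=> f0 fM; split=> //; exists M => _ [s /= us <-]; exact: fM. Qed.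

Lemma tsum_le f (M : R) :
  (forall s, uniq s -> \sum_(i <- s) f i <= M) -> tsum f <= M.
Proof.
move=> fM; apply: ge_sup; first by exists 0, [::] => //; rewrite big_nil.
by move=> _ [s /= us <-]; exact: fM.
Qed.

Lemma le_tsum f s : nnsummable f -> uniq s -> \sum_(i <- s) f i <= tsum f.
Proof. by move=> [_ fb] us; apply: sup_ubound => //; exists s. Qed.

Lemma tsum_ge0 f : nnsummable f -> 0 <= tsum f.
Proof. by move=> /(@le_tsum _ [::])/(_ isT); rewrite big_nil. Qed.

Lemma nnsummableD f g : nnsummable f -> nnsummable g ->
  nnsummable (fun i => f i + g i).
Proof.
move=> fs gs; apply: (@nnsummableP _ (tsum f + tsum g)) => [i|s us].
  by rewrite addr_ge0// ?fs.1 ?gs.1.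
by rewrite big_split lerD// le_tsum.
Qed.

Lemma nnsummableZ (r : R) f : 0 <= r -> nnsummable f ->
  nnsummable (fun i => r * f i).
Proof.
move=> r0 fs; apply: (@nnsummableP _ (r * tsum f)) => [i|s us].
  by rewrite mulr_ge0// fs.1.
by rewrite -mulr_sumr ler_wpM2l// le_tsum.
Qed.

Lemma le_nnsummable f g : (forall i, 0 <= f i <= g i) -> nnsummable g ->
  nnsummable f.
Proof.
move=> fg gs; apply: (@nnsummableP _ (tsum g)) => [i|s us].
  by case/andP : (fg i).
rewrite (le_trans _ (le_tsum gs us))// ler_sum// => i _.
by case/andP : (fg i).
Qed.

Lemma tsumD f g : nnsummable f -> nnsummable g ->
  tsum (fun i => f i + g i) = tsum f + tsum g.
Proof.
move=> fs gs; have fgs := nnsummableD fs gs; apply/eqP; rewrite eq_le.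
apply/andP; split.
  by apply: tsum_le => s us; rewrite big_split lerD// le_tsum.
rewrite -lerBrDr; apply: tsum_le => s us.
rewrite lerBrDr addrC -lerBrDr; apply: tsum_le => t ut.
rewrite lerBrDr; apply: le_trans (le_tsum fgs (undup_uniq (s ++ t))).
rewrite big_split addrC lerD//.
  by apply: ler_sum_subset => [|//||i]; rewrite ?undup_uniq//;
    [exact: fs.1|rewrite mem_undup mem_cat => ->].
apply: ler_sum_subset => [|//||i]; rewrite ?undup_uniq//.
  exact: gs.1.
by rewrite mem_undup mem_cat orbC => ->.
Qed.

Lemma tsumZ (r : R) f : 0 <= r -> nnsummable f ->
  tsum (fun i => r * f i) = r * tsum f.
Proof.
rewrite le_eqVlt => /predU1P[<-|r0] fs.
  rewrite mul0r; apply/eqP; rewrite eq_le tsum_ge0 ?andbT; last first.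
    exact: nnsummableZ.
  by apply: tsum_le => s _; rewrite -mulr_sumr mul0r.
apply/eqP; rewrite eq_le; apply/andP; split.
  by apply: tsum_le => s us; rewrite -mulr_sumr ler_pM2l// le_tsum.
rewrite -ler_pdivlMl//; apply: tsum_le => s us; rewrite ler_pdivlMl// mulr_sumr.
by apply: le_tsum => //; exact: nnsummableZ (ltW r0) fs.
Qed.

Lemma tsum0_eq0 f : nnsummable f -> tsum f = 0 -> forall i, f i = 0.
Proof.
move=> fs f0 i; apply/eqP; rewrite eq_le fs.1 andbT -f0.
by rewrite (le_trans _ (@le_tsum _ [:: i] fs _))// big_seq1.
Qed.

End UnorderedSums.

(** A partial injection is carried together with its inverse, because the
adjoint of the operator that it induces is induced by the inverse. *)
Definition pinverse (I J : Type) (h : I -> option J) (g : J -> option I) :=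
  forall i j, h i = Some j <-> g j = Some i.

Section Reindexing.
Context {R : realType}.

Lemma pinverse_sym (I J : Type) (h : I -> option J) g :
  pinverse h g -> pinverse g h.
Proof. by move=> hg j i; split=> /hg. Qed.

Lemma pmap_pinverse_uniq (I J : eqType) (h : I -> option J) g (s : seq I) :
  pinverse h g -> uniq s -> uniq (pmap h s).
Proof.
move=> hg; elim: s => //= i s IH /andP[is_ us]; case E : (h i) => [j|] /=.
  rewrite IH// andbT mem_pmap; apply: contra is_ => /mapP[i' i's].
  by move=> /esym/hg gi'; move/hg : E; rewrite gi' => -[<-].
exact: IH.
Qed.

(** A finite set of indices is mapped injectively by h where h is defined, so the
partial sums of the reindexed family are partial sums of f. *)
Lemma pull_summable (I J : choiceType) (h : I -> option J) g (f : J -> R) :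
  pinverse h g -> nnsummable f -> nnsummable (fun i => oapp f 0 (h i)) /\
    tsum (fun i => oapp f 0 (h i)) <= tsum f.
Proof.
move=> hg fs.
have le s : uniq s -> \sum_(i <- s) oapp f 0 (h i) <= tsum f.
  by move=> us; rewrite -big_pmap le_tsum// (pmap_pinverse_uniq hg).
split; last exact: tsum_le.
by apply: nnsummableP le => i; case: (h i) => //= j; exact: fs.1.
Qed.

(** Each side is a reindexing of the other, so pull_summable gives both
inequalities. *)
Lemma tsum_pull (I J : choiceType) (h : I -> option J) g (f : J -> R) :
  pinverse h g -> nnsummable f ->
  tsum (fun i => oapp f 0 (h i)) = tsum (fun j => if g j then f j else 0).
Proof.
move=> hg fs; have gh := pinverse_sym hg.
have hf : (fun i => oapp f 0 (h i)) =
    (fun i => oapp (fun j => if g j then f j else 0) 0 (h i)).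
  by apply/funext => i; case E : (h i) => [j|//] /=; move/hg : E => ->.
have gf : (fun j => if g j then f j else 0) =
    (fun j => oapp (fun i => oapp f 0 (h i)) 0 (g j)).
  by apply/funext => j; case E : (g j) => [i|//] /=; move/hg : E => ->.
have [fhs _] := pull_summable hg fs; have := pull_summable gh fhs.
rewrite -gf => -[f's le]; apply/eqP; rewrite eq_le le andbT hf.
by have [] := pull_summable hg f's.
Qed.

End Reindexing.

Section SquareSummable.
Context {R : realType}.

Definition sqmod (z : R[i]) : R := complex.Re z ^+ 2 + complex.Im z ^+ 2.

Lemma sqmod_ge0 z : 0 <= sqmod z. Proof. by rewrite addr_ge0 ?sqr_ge0. Qed.

Lemma sqmod0 : sqmod 0 = 0. Proof. by rewrite /sqmod/= expr0n addr0. Qed.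

Lemma sqmodM z w : sqmod (z * w) = sqmod z * sqmod w.
Proof. by case: z w => a b [c d]; rewrite /sqmod /=; ring. Qed.

Lemma sqmodN z : sqmod (- z) = sqmod z.
Proof. by case: z => a b; rewrite /sqmod /= !sqrrN. Qed.

Lemma sqmodD_le z w : sqmod (z + w) <= 2 * sqmod z + 2 * sqmod w.
Proof.
case: z w => a b [c d]; rewrite /sqmod /=.
have := sqr_ge0 (a - c); have := sqr_ge0 (b - d); nra.
Qed.

Lemma sqmod_eq0 z : sqmod z = 0 -> z = 0.
Proof.
case: z => a b /eqP; rewrite /sqmod /= paddr_eq0 ?sqr_ge0// !sqrf_eq0.
by move=> /andP[/eqP-> /eqP->].
Qed.

Context (I : choiceType).
Implicit Types x y : I -> R[i].

Definition sqsummable x := nnsummable (fun i => sqmod (x i)).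

Definition l2_pred : {pred (I -> R[i])} := fun x => `[< sqsummable x >].

Fact l2_submod : submod_closed l2_pred.
Proof.
split=> [|a x y /asboolP xs /asboolP ys]; apply/asboolP.
  apply: (@nnsummableP _ _ _ 0) => [i|s _]; first exact: sqmod_ge0.
  by rewrite big1// => i _; exact: sqmod0.
have s2 z : sqsummable z -> nnsummable (fun i => 2 * sqmod (z i)).
  by move=> zs; apply: nnsummableZ zs.
apply: (le_nnsummable _ (nnsummableD (nnsummableZ (sqmod_ge0 a) (s2 _ xs)) (s2 _ ys))).
move=> i; rewrite sqmod_ge0/= (le_trans (sqmodD_le _ _))//.
by rewrite sqmodM mulrCA.
Qed.

HB.instance Definition _ := GRing.isSubmodClosed.Build R[i] (I -> R[i])
  l2_pred l2_submod.

Record l2 := L2 { l2val :> I -> R[i]; l2P : l2val \in l2_pred }.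

HB.instance Definition _ := [isSub for l2val].
HB.instance Definition _ := [Choice of l2 by <:].
HB.instance Definition _ := [SubChoice_isSubLmodule of l2 by <:].

End SquareSummable.
Arguments l2 : clear implicits.

Section L2Space.
Context {R : realType} {I : choiceType}.
Implicit Types x y z : l2 R I.

Lemma l2_ext x y : (forall i, x i = y i) -> x = y.
Proof. by move=> xy; apply/val_inj/funext. Qed.

Lemma l2DE x y i : (x + y) i = x i + y i. Proof. by []. Qed.
Lemma l2BE x y i : (x - y) i = x i - y i. Proof. by []. Qed.
Lemma l2ZE (a : R[i]) x i : (a *: x) i = a * x i. Proof. by []. Qed.

Lemma l2_summable x : nnsummable (fun i => sqmod (x i)).
Proof. exact/asboolP/(l2P x). Qed.

Definition sqlen x : R := tsum (fun i => sqmod (x i)).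

Lemma sqlen_ge0 x : 0 <= sqlen x.
Proof. exact/tsum_ge0/l2_summable. Qed.

(** Polarisation. Every identity between inner products is thereby an identity
between sums of squares, and these reduce to pointwise identities after the
negative terms are moved to the other side. *)
Definition l2ip x y : R := (sqlen (x + y) - sqlen x - sqlen y) / 2.

Fact l2ipC x y : l2ip x y = l2ip y x.
Proof. by rewrite /l2ip [x + y]addrC addrAC. Qed.

Fact l2ipDl x y z : l2ip (x + y) z = l2ip x z + l2ip y z.
Proof.
have : sqlen (x + y + z) + sqlen x + sqlen y + sqlen z =
    sqlen (x + y) + sqlen (x + z) + sqlen (y + z).
  rewrite /sqlen -!tsumD; do ?[exact: l2_summable|apply: nnsummableD].
  congr tsum; apply/funext => i; rewrite !l2DE.
  by case: (x i) (y i) (z i) => a b [c d] [e f]; rewrite /sqmod /=; ring.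
rewrite /l2ip; lra.
Qed.

Fact l2ip0l y : l2ip 0 y = 0.
Proof. by have := l2ipDl 0 0 y; rewrite addr0; lra. Qed.

(** Nonnegative r first, because only nonnegative families are summed. *)
Fact l2ipZr (r : R) x y : l2ip (r%:C%C *: x) y = r * l2ip x y.
Proof.
wlog r0 : r / 0 <= r => [h|].
  have [/h//|/ltW r0] := leP 0 r.
  have := l2ipDl (r%:C%C *: x) ((- r)%:C%C *: x) y.
  rewrite -scalerDl -rmorphD subrr scale0r l2ip0l (h (- r)) ?oppr_ge0//; lra.
have : sqlen (r%:C%C *: x + y) + r * sqlen x + r * sqlen y =
    r * sqlen (x + y) + sqlen (r%:C%C *: x) + sqlen y.
  rewrite /sqlen -!tsumZ//; do ?exact: l2_summable.
  rewrite -!tsumD;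
    do ?[exact: l2_summable|apply: nnsummableZ => //|apply: nnsummableD].
  congr tsum; apply/funext => i; rewrite !l2DE !l2ZE.
  by case: (x i) (y i) => a b [c d]; rewrite /sqmod /=; ring.
rewrite /l2ip; lra.
Qed.

Fact l2ipZ (a : R[i]) x y : l2ip (a *: x) y = l2ip x (a^* *: y).
Proof.
have : sqlen (a *: x + y) + sqlen x + sqlen (a^* *: y) =
    sqlen (x + a^* *: y) + sqlen (a *: x) + sqlen y.
  rewrite /sqlen -!tsumD; do ?[exact: l2_summable|apply: nnsummableD].
  congr tsum; apply/funext => i; rewrite !l2DE !l2ZE.
  by case: (x i) (y i) a => a b [c d] [e f]; rewrite /sqmod /=; ring.
rewrite /l2ip; lra.
Qed.

Lemma l2ip_self x : l2ip x x = sqlen x.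
Proof.
have : sqlen (x + x) = sqlen x + sqlen x + sqlen x + sqlen x.
  rewrite /sqlen -!tsumD; do ?[exact: l2_summable|apply: nnsummableD].
  congr tsum; apply/funext => i; rewrite !l2DE.
  by case: (x i) => a b; rewrite /sqmod /=; ring.
rewrite /l2ip; lra.
Qed.

Fact l2ip_ge0 x : 0 <= l2ip x x.
Proof. by rewrite l2ip_self sqlen_ge0. Qed.

Fact l2ip_eq0 x : l2ip x x = 0 -> x = 0.
Proof.
rewrite l2ip_self => /(tsum0_eq0 (l2_summable x)) x0.
by apply: l2_ext => i; apply: sqmod_eq0.
Qed.

End L2Space.

Section L2Complete.
Context {R : realType} {I : choiceType}.
Implicit Types x y z : l2 R I.

Lemma sqlenD_le x y : sqlen (x + y) <= 2 * sqlen x + 2 * sqlen y.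
Proof.
rewrite /sqlen -!tsumZ//; do ?exact: l2_summable.
rewrite -tsumD; do ?[apply: nnsummableZ => //|exact: l2_summable].
apply: tsum_le => s us; rewrite (le_trans _ (le_tsum _ us))//; last first.
  by apply: nnsummableD; apply: nnsummableZ => //; exact: l2_summable.
by apply: ler_sum => i _; exact: sqmodD_le.
Qed.

Lemma sqmod_le_sqlen x i : sqmod (x i) <= sqlen x.
Proof. by rewrite (le_trans _ (@le_tsum _ _ _ [:: i] (l2_summable x) _))// big_seq1. Qed.

Section Limit.
Variable F : set_system (l2 R I).
Hypotheses (FF : ProperFilter F)
  (Fc : forall e : R, 0 < e -> exists x, F [set y | sqlen (y - x) <= e ^+ 2]).

(** Applied to the real and imaginary parts of each coordinate. *)
Lemma l2_coord_cvg (phi : l2 R I -> R) :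
  (forall x y, (phi y - phi x) ^+ 2 <= sqlen (y - x)) ->
  exists l : R, phi @ F --> l.
Proof.
move=> phi_le; suff : cvg (phi @ F) by move=> ?; exists (lim (phi @ F)).
apply: cauchy_cvg; apply: cauchy_exP => e e0.
have e2 : 0 < e / 2 by rewrite divr_gt0.
have [x Fx] := Fc e2; exists (phi x).
apply: (@filterS _ F _ _ (phi @^-1` _) _ Fx) => y /= yx.
rewrite -ball_normE /= distrC (@le_lt_trans _ _ (e / 2))//.
  rewrite -(@ler_pXn2r _ 2) ?nnegrE ?(ltW e2)// real_normK ?num_real//.
  by rewrite (le_trans (phi_le _ _)).
by rewrite ltr_pdivrMr// ltr_pMr// ltr1n.
Qed.

Lemma Re_coord_ex i : exists l : R, (fun x : l2 R I => complex.Re (x i)) @ F --> l.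
Proof.
apply: l2_coord_cvg => x y; rewrite (le_trans _ (sqmod_le_sqlen _ i))// l2BE.
by rewrite /sqmod; case: (x i) (y i) => a b [c d] /=; rewrite lerDl sqr_ge0.
Qed.

Lemma Im_coord_ex i : exists l : R, (fun x : l2 R I => complex.Im (x i)) @ F --> l.
Proof.
apply: l2_coord_cvg => x y; rewrite (le_trans _ (sqmod_le_sqlen _ i))// l2BE.
by rewrite /sqmod; case: (x i) (y i) => a b [c d] /=; rewrite lerDr sqr_ge0.
Qed.

(** The limit is taken coordinatewise; bounds on finite partial sums are closed
conditions and survive in the limit. *)
Lemma l2_limit : exists x, forall e : R, 0 < e -> F [set y | sqlen (y - x) <= e ^+ 2].
Proof.
have [re reP] := choice Re_coord_ex; have [im imP] := choice Im_coord_ex.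
pose l i := Complex (re i) (im i).
have bound (x : l2 R I) e s : F [set y | sqlen (y - x) <= e ^+ 2] -> uniq s ->
    \sum_(i <- s) sqmod (l i - x i) <= e ^+ 2.
  move=> Fx us.
  have lim : (fun y : l2 R I => \sum_(i <- s) sqmod (y i - x i)) @ F -->
      \sum_(i <- s) sqmod (l i - x i).
    elim: s {us} => [|i s IH].
      rewrite big_nil (_ : (fun=> _) = (fun=> 0)); first exact: cvg_cst.
      by apply/funext => y; rewrite big_nil.
    rewrite big_cons; have -> : (fun y : l2 R I => \sum_(j <- i :: s) sqmod (y j - x j)) =
      (fun y : l2 R I => (complex.Re (y i) - complex.Re (x i)) ^+ 2 +
         (complex.Im (y i) - complex.Im (x i)) ^+ 2 +
         \sum_(j <- s) sqmod (y j - x j)).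
      by apply/funext => y; rewrite big_cons /sqmod; case: (y i) (x i) => a b [c d].
    apply: cvgD => //; rewrite /sqmod /l; case: (x i) => a b /=.
    have sub (f : l2 R I -> R) k c : f @ F --> k ->
        (fun y => (f y - c) ^+ 2) @ F --> (k - c) ^+ 2.
      move=> fk; rewrite expr2; under eq_fun do rewrite expr2.
      by apply: cvgM; apply: cvgB => //; exact: cvg_cst.
    by apply: cvgD; apply: sub.
  have := closed_cvg _ (@closed_le R (e ^+ 2)) _ _ lim; apply.
  apply: (@filterS _ F _ _ _ _ Fx) => y /= yx.
  by rewrite (le_trans _ yx)//; apply: (le_tsum (l2_summable (y - x)) us).
have [x1 Fx1] := Fc ltr01.
have lx1 : (l \- x1)%R \in @l2_pred R I.
  apply/asboolP/(@nnsummableP _ _ _ (1 ^+ 2)) => [i|s us]; last exact: bound.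
  exact: sqmod_ge0.
have ls : l \in @l2_pred R I.
  have -> : l = (l \- x1) + x1 by apply/funext => i; rewrite fctE /= subrK.
  by apply: rpredD => //; exact: l2P.
exists (L2 ls) => e e0; have e2 : 0 < e / 2 by rewrite divr_gt0.
have [x Fx] := Fc e2; apply: filterS (Fx) => y /= yx.
have lx : sqlen (x - L2 ls) <= (e / 2) ^+ 2.
  apply: tsum_le => s us; rewrite (eq_bigr (fun i => sqmod (l i - x i))) ?bound//.
  by move=> i _; rewrite l2BE -opprB sqmodN.
rewrite -(subrK x y) -addrA (le_trans (sqlenD_le _ _))//.
by move: yx lx; nra.
Qed.

End Limit.

Fact l2ip_complete (F : set_system (l2 R I)) : ProperFilter F ->
  (forall e : R, 0 < e ->
     exists x, F [set y | Num.sqrt (l2ip (y - x) (y - x)) <= e]) ->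
  exists x, forall e : R, 0 < e ->
     F [set y | Num.sqrt (l2ip (y - x) (y - x)) <= e].
Proof.
have E (x : l2 R I) (e : R) : 0 < e ->
    [set y | Num.sqrt (l2ip (y - x) (y - x)) <= e] = [set y | sqlen (y - x) <= e ^+ 2].
  move=> e0; apply/seteqP; split => y /=; rewrite l2ip_self;
  by rewrite -[X in X <= e ^+ 2](sqr_sqrtr (sqlen_ge0 _)) ler_pXn2r// ?nnegrE ?sqrtr_ge0// ltW.
move=> FF Fc; have [e e0|x Fx] := l2_limit FF.
  by have [x] := Fc e e0; rewrite E//; exists x.
by exists x => e e0; rewrite E//; exact: Fx.
Qed.

Definition l2_hilbert : hilbert R :=
  Hilbert l2ipC l2ipDl l2ipZr l2ipZ l2ip_ge0 l2ip_eq0 l2ip_complete.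

End L2Complete.
Arguments l2_hilbert : clear implicits.

(** * Operators induced by partial injections *)

Section PullOperators.
Context {R : realType} {I : choiceType}.
Variables (h g : I -> option I) (hg : pinverse h g).
Implicit Types x y : l2_hilbert R I.

Fact pull_l2 (x : l2 R I) : (fun i => oapp x 0 (h i)) \in @l2_pred R I.
Proof.
apply/asboolP.
have := (pull_summable hg (l2_summable x)).1; congr nnsummable.
by apply/funext => i; case: (h i) => //=; rewrite sqmod0.
Qed.

Definition pull (x : l2_hilbert R I) : l2_hilbert R I := L2 (pull_l2 x).

Lemma pullE (x : l2 R I) i : l2val (pull x) i = oapp x 0 (h i). Proof. by []. Qed.

Lemma sqlen_pull_le (x : l2 R I) : sqlen (pull x) <= sqlen x.
Proof.
have := (pull_summable hg (l2_summable x)).2; apply: le_trans.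
rewrite le_eqVlt; apply/predU1P; left; congr tsum.
by apply/funext => i; rewrite pullE; case: (h i) => //=; rewrite sqmod0.
Qed.

End PullOperators.

Section PullAdjoint.
Context {R : realType} {I : choiceType}.

Lemma tsum0 : tsum (fun _ : I => 0 : R) = 0.
Proof.
have s0 : nnsummable (fun _ : I => 0 : R).
  by apply: (@nnsummableP _ _ _ 0) => // s _; rewrite big1.
by have := tsumZ (lexx 0) s0; under eq_fun do rewrite mul0r; rewrite mul0r.
Qed.

Lemma tsum_split (P : pred I) (f : I -> R) : nnsummable f ->
  tsum f = tsum (fun i => if P i then f i else 0) +
           tsum (fun i => if P i then 0 else f i).
Proof.
move=> fs; rewrite -tsumD; last 2 first.
- by apply: (le_nnsummable _ fs) => i; case: ifP; rewrite fs.1 lexx.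
- by apply: (le_nnsummable _ fs) => i; case: ifP; rewrite fs.1 lexx.
by congr tsum; apply/funext => i; case: ifP; rewrite ?addr0 ?add0r.
Qed.

(** By polarisation both sides are sums over the domains of h and of g; outside of
the domain of h the terms of |pull x + y|^2 and |y|^2 cancel. The bijection
between the two domains matches the remaining terms. *)
Lemma pull_adjoint (h g : I -> option I) (hg : pinverse h g) (gh : pinverse g h) :
  adjoint_pair (@pull R I h g hg) (pull gh).
Proof.
have split (h' g' : I -> option I) (hg' : pinverse h' g') (z w : l2 R I) :
  sqlen (pull hg' z + w) - sqlen (pull hg' z) - sqlen w =
    tsum (fun i => if h' i then sqmod (pull hg' z i + w i) else 0) -
    tsum (fun i => if h' i then sqmod (pull hg' z i) else 0) -
    tsum (fun i => if h' i then sqmod (w i) else 0).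
  rewrite {1}/sqlen (tsum_split h'); last exact: l2_summable.
  rewrite [sqlen w](tsum_split h'); last exact: l2_summable.
  rewrite [sqlen (pull _ _)](tsum_split h'); last exact: l2_summable.
  have -> : (fun i => if h' i then 0 else sqmod ((pull hg' z + w) i)) =
            (fun i => if h' i then 0 else sqmod (w i)).
    by apply/funext => i; rewrite l2DE pullE; case: (h' i) => //=; rewrite add0r.
  have -> : (fun i => if h' i then 0 else sqmod (pull hg' z i)) = (fun=> 0).
    by apply/funext => i; rewrite pullE; case: (h' i) => //=; rewrite sqmod0.
  rewrite tsum0; ring.
move=> x y; rewrite /= /l2ip split [x + _]addrC [_ - sqlen x - _]addrAC split.
have fin k (k' : I -> option I) (kk : pinverse k k') (z : l2 R I) f :
    (forall i j, k i = Some j -> f i = sqmod (z j)) ->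
    tsum (fun i => if k i then f i else 0) =
    tsum (fun j => if k' j then sqmod (z j) else 0).
  move=> kf; rewrite -(tsum_pull kk (l2_summable z)); congr tsum.
  by apply/funext => i; case E : (k i) => [j|//]; exact: kf.
rewrite (fin _ _ hg (pull gh y + x)); last first.
  by move=> i j hi; rewrite l2DE !pullE hi (hg i j).1//= addrC.
rewrite (fin _ _ hg x); last by move=> i j hi; rewrite pullE hi.
rewrite -(fin _ _ gh y (fun j => sqmod (pull gh y j))); last first.
  by move=> i j hi; rewrite pullE hi.
by rewrite addrAC.
Qed.

Lemma pull_adjointable (h g : I -> option I) (hg : pinverse h g) :
  @pull R I h g hg \in @adjointable_pred R (l2_hilbert R I).
Proof.
apply/asboolP; split.
- move=> a x; apply: l2_ext => i; rewrite pullE l2ZE pullE.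
  by case: (h i) => //=; rewrite mulr0.
- by exists (pull (pinverse_sym hg)); exact: pull_adjoint.
- exists 1; split=> // x; rewrite mul1r /hnorm ler_sqrt ?ip_ge0//=.
  by rewrite !l2ip_self sqlen_pull_le.
Qed.

Definition pullop h g (hg : pinverse h g) : adjop (l2_hilbert R I) :=
  AdjOp (pull_adjointable hg).

Lemma pullopE h g (hg : pinverse h g) (x : l2 R I) i :
  l2val (pullop hg x) i = oapp x 0 (h i).
Proof. by []. Qed.

Lemma cadj_pullop h g (hg : pinverse h g) (gh : pinverse g h) :
  cadj (pullop hg) = pullop gh.
Proof. by apply: adj_unique; exact: pull_adjoint. Qed.

Lemma l2op_ext (T S : adjop (l2_hilbert R I)) :
  (forall (x : l2 R I) i, l2val (T x) i = l2val (S x) i) -> T = S.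
Proof. by move=> TS; apply: op_ext => x; apply: l2_ext => i; exact: TS. Qed.

(** Range projections of the operators induced by partial injections are
restrictions to subsets of the index set, so relations between them are Boolean
identities. *)
Definition restr (D : pred I) i := if D i then Some i else None.

Lemma restr_pinverse D : pinverse (restr D) (restr D).
Proof. by move=> i j; rewrite /restr; split; case: ifP => // D1 [<-]; rewrite D1. Qed.

Definition restrop D := pullop (restr_pinverse D).

Lemma restropE D (x : l2 R I) i :
  l2val (restrop D x) i = if D i then x i else 0.
Proof. by rewrite pullopE /restr; case: ifP. Qed.

Lemma cadj_restrop D : cadj (restrop D) = restrop D.
Proof. exact: cadj_pullop. Qed.

Lemma restrop_mul D D' : restrop D ** restrop D' = restrop (predI D D').
Proof.
apply: l2op_ext => x i; rewrite [LHS]restropE !restropE /=.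
by case: (D i).
Qed.

Lemma restrop0 D : (forall i, ~~ D i) -> restrop D = 0.
Proof. by move=> D0; apply: l2op_ext => x i; rewrite restropE (negbTE (D0 i)). Qed.

Lemma restrop_sum (J : eqType) (s : seq J) (D : J -> pred I) : uniq s ->
  (forall i e e', e \in s -> e' \in s -> D e i -> D e' i -> e = e') ->
  \sum_(e <- s) restrop (D e) = restrop (fun i => has (fun e => D e i) s).
Proof.
elim: s => [|e s IH] /=; first by rewrite big_nil restrop0.
move=> /andP[es us] disj; rewrite big_cons IH//; last first.
  by move=> i a b as_ bs; apply: disj; rewrite inE ?as_ ?bs orbT.
apply: l2op_ext => x i; rewrite opDE l2DE !restropE.
have [Dei|_] := boolP (D e i); rewrite /= ?add0r//.
case: hasP => [[e' e's De'i]|_]; last by rewrite addr0.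
have ee : e = e' by apply: (disj i) => //; rewrite inE ?eqxx ?e's ?orbT.
by rewrite ee e's in es.
Qed.

Lemma restrop_neq0 (D : pred I) i : D i -> restrop D <> 0.
Proof.
move=> Di.
have ds : (fun j => (j == i)%:R) \in @l2_pred R I.
  apply/asboolP/(@nnsummableP _ _ _ 1) => [j|s us]; first exact: sqmod_ge0.
  rewrite (@le_trans _ _ (\sum_(j <- s) (j == i)%:R))//.
    apply: ler_sum => j _; case: eqP => _ /=; rewrite ?sqmod0//.
    by rewrite /sqmod/= expr1n expr0n addr0.
  rewrite -natr_sum big_mkcond/= -(big_mkcond (fun j => j == i) (fun=> 1%N)).
  by rewrite sum1_count count_uniq_mem// lern1 leq_b1.
move=> /(congr1 (fun T : adjop (l2_hilbert R I) => l2val (T (L2 ds)) i)).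
by rewrite restropE Di /= eqxx => /eqP; rewrite oner_eq0.
Qed.

End PullAdjoint.

(** * A Cuntz-Krieger family from a branching system *)

Section BranchingSystem.
Context {R : realType} (E : digraph) (hE : row_finite E).
Implicit Types (v w : vertex E) (e f : edge E).

Definition into v : seq (edge E) := finmap.enum_fset (fset_set (edges_into v)).

Lemma mem_into v e : (e \in into v) = (rng e == v).
Proof.
rewrite (in_fset_set (hE v)).
by apply/idP/eqP => [/set_mem//|ev]; exact/mem_set.
Qed.

Lemma into_uniq v : uniq (into v). Proof. exact: finmap.fset_uniq. Qed.

Definition slot e := index e (into (rng e)).

Lemma slot_lt e : (slot e < size (into (rng e)))%N.
Proof. by rewrite index_mem mem_into. Qed.

Lemma slot_inj e f : rng e = rng f -> slot e = slot f -> e = f.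
Proof.
rewrite /slot => ef; rewrite ef => /(congr1 (nth e (into (rng f)))).
by rewrite !nth_index ?mem_into ?ef.
Qed.

(** The cells over v are the pairs (v, n). An edge e maps the cells over its source
bijectively to the cells over its range whose second component is congruent to
slot e modulo the number of edges into that range. *)
Definition cell : choiceType := (vertex E * nat)%type.

Definition in_range e (i : cell) :=
  (i.1 == rng e) && (i.2 %% size (into i.1) == slot e)%N.

Definition back e (i : cell) : option cell :=
  if in_range e i then Some (src e, (i.2 %/ size (into i.1))%N) else None.

Definition forth e (i : cell) : option cell :=
  if i.1 == src e
  then Some (rng e, (i.2 * size (into (rng e)) + slot e)%N) else None.

Lemma back_forth e : pinverse (back e) (forth e).
Proof.
move=> [w m] [u n]; rewrite /back /forth /in_range /=; split.
  case: ifP => // /andP[/eqP-> /eqP me] [<- <-]; rewrite eqxx -me.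
  by rewrite -divn_eq.
case: ifP => // /eqP-> [<- <-]; rewrite eqxx modnMDl modn_small ?slot_lt// eqxx/=.
have k0 : (0 < size (into (rng e)))%N := leq_ltn_trans (leq0n _) (slot_lt e).
by rewrite divnMDl// divn_small ?slot_lt// addn0.
Qed.

Let B : cStarAlgType R := adjop (l2_hilbert R cell).

Definition ck_proj v : B := restrop (fun i : cell => i.1 == v).

Definition ck_edge e : B := pullop (back_forth e).

Lemma ck_edgeE e (x : l2 R cell) i :
  l2val (ck_edge e x) i = oapp x 0 (back e i).
Proof. by []. Qed.

Lemma cadj_ck_edge e : cadj (ck_edge e) = pullop (pinverse_sym (back_forth e)).
Proof. exact: cadj_pullop. Qed.

Lemma ck_edge_initial e : cadj (ck_edge e) ** ck_edge e = ck_proj (src e).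
Proof.
rewrite cadj_ck_edge; apply: l2op_ext => x i; rewrite restropE.
rewrite pullopE; case Ei : (forth e i) => [j|] /=; last first.
  by move: Ei; rewrite /forth; case: ifP.
have ji := (back_forth e j i).2 Ei; rewrite [LHS](ck_edgeE e x j) ji /=.
by move: Ei; rewrite /forth; case: ifP.
Qed.

Lemma ck_edge_final e : ck_edge e ** cadj (ck_edge e) = restrop (in_range e).
Proof.
rewrite cadj_ck_edge; apply: l2op_ext => x i; rewrite restropE.
rewrite ck_edgeE; case Ei : (back e i) => [j|] /=; last first.
  by move: Ei; rewrite /back; case: ifP.
have ij := (back_forth e i j).1 Ei.
rewrite [LHS](pullopE (pinverse_sym (back_forth e)) x j) ij /=.
by move: Ei; rewrite /back; case: ifP.
Qed.

Lemma sum_ck_final v (F : set (edge E)) : finite_set F -> F `<=` edges_into v ->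
  \sum_(e \in F) (ck_edge e ** cadj (ck_edge e)) =
  restrop (fun i => has (fun e => in_range e i) (finmap.enum_fset (fset_set F))).
Proof.
move=> Ffin Fv; rewrite fsbig_finite//=.
under eq_bigr do rewrite ck_edge_final.
rewrite restrop_sum ?finmap.fset_uniq// => i e f _ _.
move=> /andP[/eqP ie /eqP se] /andP[/eqP jf /eqP sf].
by apply: slot_inj; [rewrite -ie -jf|rewrite -se -sf].
Qed.

Lemma ck_proj_neq0 v : ck_proj v <> 0.
Proof. by apply: (@restrop_neq0 _ _ _ (v, 0%N)) => /=. Qed.

(** The gap between a projection and a partial sum of range projections is itself
a restriction, hence a projection and in particular positive. *)
Lemma ck_family : CK_family ck_proj ck_edge.
Proof.
split; first split.
- split=> [v|v w vw].
    split; last exact: cadj_restrop.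
    rewrite [LHS]restrop_mul; congr restrop; apply/funext => i /=.
    by rewrite andbb.
  rewrite [LHS]restrop_mul restrop0// => i /=; apply/negP => /andP[/eqP -> /eqP].
  exact: vw.
- exact: ck_edge_initial.
- move=> v F Ffin Fv; rewrite (sum_ck_final Ffin Fv).
  pose D := fun i : cell =>
    (i.1 == v) && ~~ has (fun e => in_range e i) (finmap.enum_fset (fset_set F)).
  exists (restrop D); rewrite cadj_restrop restrop_mul.
  apply: l2op_ext => x i; rewrite opBE l2BE !restropE /= andbb /D.
  case: hasP => [[e]|_]; last by rewrite andbT subr0.
  rewrite in_fset_set// => /set_mem/Fv <- /andP[-> _] /=.
  by rewrite subrr.
- move=> v [e0 e0v] vfin; rewrite (sum_ck_final (v := v))//.
  congr restrop; apply/funext => -[w m] /=; apply/esym; apply/idP/idP.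
    move=> /hasP[e]; rewrite in_fset_set// => /set_mem <-.
    by case/andP.
  move=> /eqP ->; apply/hasP.
  have k0 : (0 < size (into v))%N.
    by rewrite -e0v (leq_ltn_trans (leq0n _) (slot_lt e0)).
  have mk : (m %% size (into v) < size (into v))%N by rewrite ltn_mod.
  exists (nth e0 (into v) (m %% size (into v))); first exact: mem_nth.
  have /eqP rv : rng (nth e0 (into v) (m %% size (into v))) == v.
    by rewrite -mem_into mem_nth.
  by rewrite /in_range /= rv eqxx /= /slot rv index_uniq// into_uniq.
Qed.

Lemma into_no_entrance mu e : no_entrance mu -> e \in mu -> into (rng e) = [:: e].
Proof.
move=> ne emu; apply: perm_small_eq => //; apply: uniq_perm => //; first exact: into_uniq.
move=> f; rewrite mem_into inE; apply/eqP/eqP => [fe|->//].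
exact: (ne _ _ emu fe).
Qed.

(** The modulus is 1 here, so the edge moves the vertex and keeps n. *)
Lemma ck_edge_no_entrance mu e (x : l2 R cell) w m : no_entrance mu -> e \in mu ->
  l2val (ck_edge e x) (w, m) = if w == rng e then x (src e, m) else 0.
Proof.
move=> ne emu; rewrite ck_edgeE /back /in_range /=.
case: eqP => [->|//]; rewrite /slot (into_no_entrance ne emu) /= eqxx.
by rewrite modn1 divn1.
Qed.

Lemma path_elt_rcons (A : cStarAlgType R) (s : edge E -> A) e l f :
  path_elt s e (rcons l f) = path_elt s e l ** s f.
Proof. by rewrite /path_elt foldl_rcons. Qed.

Lemma ck_path_no_entrance mu e l (x : l2 R cell) w m : no_entrance mu ->
  {subset e :: l <= mu} -> is_path (e :: l) ->
  l2val (path_elt ck_edge e l x) (w, m) =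
  if w == rng e then x (src (last e l), m) else 0.
Proof.
move=> ne; elim/last_ind : l x w m => [|l f IH] x w m sub.
  by move=> _; apply: ck_edge_no_entrance ne (sub _ (mem_head _ _)).
rewrite /is_path /= rcons_path => /andP[pl /eqP lf].
rewrite path_elt_rcons [LHS](IH (ck_edge f x)) //; last first.
  by move=> g gl; apply: sub; rewrite -rcons_cons mem_rcons inE gl orbT.
case: ifP => // _; rewrite (ck_edge_no_entrance _ _ _ ne); last first.
  by apply: sub; rewrite -rcons_cons mem_rcons inE eqxx.
by rewrite lf eqxx last_rcons.
Qed.

Lemma ck_normalised : normalised_reduced_CK_family ck_proj ck_edge.
Proof.
split; first exact: ck_family.
move=> e l [pl closed _] ne; apply: l2op_ext => x [w m].
rewrite (ck_path_no_entrance _ _ _ ne)// restropE /=.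
by case: eqP => // ->; rewrite closed.
Qed.

End BranchingSystem.

(** * Cycles without entrance and cutting sets *)

Section Cycles.
Context {E : digraph}.
Implicit Types (mu nu : seq (edge E)) (e f x : edge E).

Let step e f := src e == rng f.

Lemma is_cycleP mu : is_cycle mu <->
  [/\ mu != [::], path.cycle step mu & uniq (map src mu)].
Proof.
case: mu => [|e l] /=; first by split=> // -[].
rewrite rcons_path; split.
  by move=> [pl cl ul]; split=> //; apply/andP; split=> //; rewrite /step -cl.
by move=> [_ /andP[pl /eqP cl] ul]; split.
Qed.

Lemma cycle_uniq mu : is_cycle mu -> uniq mu.
Proof. by move=> /is_cycleP[_ _]; exact: map_uniq. Qed.

Lemma is_cycle_rot k mu : is_cycle mu -> is_cycle (rot k mu).
Proof.
move=> /is_cycleP[mu0 cmu umu]; apply/is_cycleP; split.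
- by rewrite -size_eq0 size_rot size_eq0.
- by rewrite rot_cycle.
- by rewrite map_rot rot_uniq.
Qed.

Lemma no_entrance_rot k mu : no_entrance mu -> no_entrance (rot k mu).
Proof. by move=> ne e f; rewrite mem_rot; exact: ne. Qed.

(** A cycle without entrance determines its edges backwards: the edge following x
in nu has range s(x), and so does the one following x in mu, which is the only edge
with this range. *)
Lemma cycle_closed mu nu x : is_cycle mu -> no_entrance mu -> is_cycle nu ->
  x \in mu -> x \in nu -> {subset nu <= mu}.
Proof.
move=> /is_cycleP[_ cmu _] ne nuc xmu xnu.
have [k l kl] := rot_to xnu.
have : is_cycle (x :: l) by rewrite -kl; exact: is_cycle_rot.
move=> /= [pl _ _] f; rewrite -(mem_rot k) kl.
elim: l x xmu pl {xnu kl} => [|b l IH] x xmu /=; first by rewrite inE => _ /eqP ->.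
move=> /andP[/eqP xb pl]; rewrite inE => /predU1P[->//|]; apply: IH => //.
have /eqP xn := next_cycle cmu xmu.
have nmu : next mu x \in mu by rewrite mem_next.
have -> : b = next mu x by apply: (ne _ _ nmu); rewrite -xb.
exact: nmu.
Qed.

(** In each cycle without entrance the edge with the smallest code is chosen; by
cycle_closed this depends only on the set of edges of the cycle. *)
Lemma exists_cutting_set : exists X : set (edge E), cutting_set X.
Proof.
exists [set x | exists mu, [/\ is_cycle mu, no_entrance mu, x \in mu &
  forall y, y \in mu -> (pickle x <= pickle y)%N]]; split.
  move=> x [mu [cmu ne xmu _]]; exists (cycle_class mu); first by exists mu.
  by exists mu => //; exists 0%N => //; exact: rot0.
move=> _ [mu [cmu ne] <-].
have clE : class_edges (cycle_class mu) = [set` mu].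
  apply/seteqP; split => [y [_ [k _ <-]] /=|y ymu]; first by rewrite mem_rot.
  by exists mu => //; exists 0%N => //; exact: rot0.
have exn : exists n, has (fun e => pickle e == n) mu.
  case: mu cmu {ne clE} => // e l _; exists (pickle e).
  by rewrite /= eqxx.
have [n /hasP[x xmu /eqP xn] nmin] := ex_minnP exn.
have xmin y : y \in mu -> (pickle x <= pickle y)%N.
  by move=> ymu; rewrite xn; apply: nmin; apply/hasP; exists y.
exists x; rewrite clE; apply/seteqP; split => [z [[nu [cnu nne znu zmin]] zmu]|_ ->].
  apply: (pcan_inj pickleK); apply/eqP; rewrite eqn_leq xmin// andbT.
  by apply: zmin; apply: (cycle_closed cnu nne cmu znu zmu).
by split=> //; exists mu.
Qed.

Lemma cutting_set_cycle (X : set (edge E)) x : cutting_set X -> X x ->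
  exists l, [/\ is_cycle (x :: l), no_entrance (x :: l) &
                forall f, f \in l -> ~ X f].
Proof.
move=> [Xsub Xone] Xx.
have [_ [mu [cmu ne] <-] [_ [k _ <-] xk]] := Xsub _ Xx.
have {xk} xmu : x \in mu by move: xk; rewrite /= mem_rot.
have clmu f : f \in mu -> class_edges (cycle_class mu) f.
  by move=> fmu; exists mu => //; exists 0%N => //; exact: rot0.
have [y Xy] : exists y, X `&` class_edges (cycle_class mu) = [set y].
  by apply: Xone; exists mu.
have yE f : f \in mu -> X f -> f = y.
  by move=> fmu Xf; have : [set y] f by rewrite -Xy; split=> //; exact: clmu.
have [j l jl] := rot_to xmu; exists l; split.
- by rewrite -jl; exact: is_cycle_rot.
- by rewrite -jl; exact: no_entrance_rot.
move=> f fl Xf; have : uniq (x :: l) by rewrite -jl rot_uniq cycle_uniq.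
rewrite /= (yE x xmu Xx) -(yE f _ Xf) ?fl//.
by rewrite -(mem_rot j) jl inE fl orbT.
Qed.

End Cycles.

(** * Generated subalgebras *)

Section GeneratedSubalgebra.
Context {R : realType}.

Lemma cstar_gen_subalgebra (A : cStarAlgType R) (G : set A) :
  cstar_subalgebra (cstar_gen G).
Proof.
split.
- by apply: closed_bigI => D [[]].
- split=> [D [[_ []]]//|x y Dx Dy D DG].
  by case: (DG) => -[_ [_ +] _ _ _] _; apply; [exact: Dx|exact: Dy].
- move=> a x Dx D DG; case: (DG) => -[_ _ + _ _] _; apply; exact: Dx.
- move=> x y Dx Dy D DG; case: (DG) => -[_ _ _ + _] _; apply; [exact: Dx|exact: Dy].
- move=> x Dx D DG; case: (DG) => -[_ _ _ _ +] _; apply; exact: Dx.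
Qed.

Lemma sub_cstar_gen (A : cStarAlgType R) (G : set A) : G `<=` cstar_gen G.
Proof. by move=> x Gx D [_ GD]; exact: GD. Qed.

Lemma cstar_gen_min (A : cStarAlgType R) (G D : set A) : cstar_subalgebra D ->
  G `<=` D -> cstar_gen G `<=` D.
Proof. by move=> Da GD x; apply; split. Qed.

(** The fixed points of f form a C*-subalgebra; that they are closed is where
automatic continuity enters. *)
Lemma hom_eq_on_generators (A : cStarAlgType R) (f : A -> A) (G : set A) :
  star_hom_on setT f -> cgenerates G -> (forall x, G x -> f x = x) ->
  forall x, f x = x.
Proof.
move=> fh Ggen fG x.
have [fD fZ fM fV] := fh.
have fN y : f (- y) = - f y by rewrite -scaleN1r fZ// scaleN1r.
have f0 : f 0 = 0 by rewrite -(scale0r (0 : A)) fZ// !scale0r.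
suff : [set y | f y - y = 0] x by move=> /= /eqP; rewrite subr_eq0 => /eqP.
have : cstar_gen G x by rewrite Ggen.
apply: cstar_gen_min => [|y Gy /=]; last by rewrite fG// subrr.
split.
- apply: (closed_eq0 (K := 2)) => [y z|y].
    by rewrite fD// fN !opprB addrACA [RHS]addrACA [- y - _]addrC.
  by rewrite (le_trans (ler_normB _ _))// mulr_natl mulr2n lerD// hom_le.
- split=> [/=|y z /= /subr0_eq fy /subr0_eq fz]; first by rewrite f0 subrr.
  by rewrite fD// fy fz subrr.
- by move=> a y /= /subr0_eq fy; rewrite fZ// fy subrr.
- by move=> y z /= /subr0_eq fy /subr0_eq fz; rewrite fM// fy fz subrr.
- by move=> y /= /subr0_eq fy; rewrite fV// fy subrr.
Qed.

End GeneratedSubalgebra.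

(** * Changing the generators of the minimal algebra *)

Section FamilyTheory.
Context {R : realType} {E : digraph}.

Lemma path_elt_cons (A : cStarAlgType R) (s : edge E -> A) e f l :
  path_elt s e (f :: l) = s e ** path_elt s f l.
Proof.
elim/last_ind: l => [//|l g IH].
by rewrite -rcons_cons !path_elt_rcons IH cmulA.
Qed.

Lemma path_elt_gen (A : cStarAlgType R) (s : edge E -> A) (D : set A) e l :
  cstar_subalgebra D -> (forall f, f \in e :: l -> D (s f)) ->
  D (path_elt s e l).
Proof.
move=> [_ _ _ DM _]; elim: l e => [|f l IH] e Ds.
  by apply: Ds; rewrite mem_head.
rewrite path_elt_cons; apply: DM; first by apply: Ds; rewrite mem_head.
by apply: IH => g gl; apply: Ds; rewrite inE gl orbT.
Qed.

Lemma hom_path_elt (A B : cStarAlgType R) (t : edge E -> B) (D : set B)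
    (f : B -> A) e l :
  cstar_subalgebra D -> star_hom_on D f -> (forall e, D (t e)) ->
  f (path_elt t e l) = path_elt (f \o t) e l.
Proof.
move=> Da fh Dt; have [_ _ fM _] := fh; elim: l e => [//|g l IH] e.
rewrite !path_elt_cons fM ?IH//.
by apply: path_elt_gen.
Qed.

Lemma eq_path_elt (A : cStarAlgType R) (s s' : edge E -> A) e l :
  (forall f, f \in e :: l -> s f = s' f) -> path_elt s e l = path_elt s' e l.
Proof.
elim: l e => [|f l IH] e ss; first by apply: ss; rewrite mem_head.
rewrite !path_elt_cons ss ?mem_head// IH// => g gl.
by apply: ss; rewrite inE gl orbT.
Qed.

Section OneFamily.
Context {A : cStarAlgType R} (p : vertex E -> A) (s : edge E -> A).

(** The C*-identity reduces this to the vanishing of the square of s - s p. *)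
Lemma TCK_edge_src e : TCK_family p s -> s e ** p (src e) = s e.
Proof.
move=> [[pp _] ss _]; have [pi pa] := pp (src e).
apply/esym/eqP; rewrite -subr_eq0; apply/eqP/cstar_eq0.
rewrite cadjB cadjM pa cmulBl !cmulBr ss.
rewrite -!cmulA (cmulA (cadj (s e)) (s e) (p _)) ss !pi.
by rewrite !subrr.
Qed.

(** The only edge into the range of an edge g of mu is g, so the Cuntz-Krieger
relation at this vertex has a single term; products telescope. *)
Lemma entryless_final mu f l : CK_family p s -> no_entrance mu ->
  {subset f :: l <= mu} -> is_path (f :: l) ->
  path_elt s f l ** cadj (path_elt s f l) = p (rng f).
Proof.
move=> [ptck pck] ne; have single g : g \in mu -> s g ** cadj (s g) = p (rng g).
  move=> gmu; have -> : p (rng g) = \sum_(e \in [set g]) (s e ** cadj (s e)).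
    have eg : edges_into (rng g) = [set g].
      apply/seteqP; split=> [e /= eg|_ ->//].
      exact: (ne _ _ gmu eg).
    rewrite pck ?eg//; by exists g.
  by rewrite fsbig_set1.
elim: l f => [|g l IH] f sub; first by move=> _; apply/single/sub/mem_head.
rewrite /is_path /= => /andP[/eqP fg pl]; rewrite path_elt_cons cadjM.
rewrite cmulA -(cmulA (s f)) IH//; last first.
  by move=> h hl; apply: sub; rewrite inE hl orbT.
by rewrite -fg TCK_edge_src//; apply/single/sub/mem_head.
Qed.

Lemma path_elt_src f l : TCK_family p s ->
  path_elt s f l ** p (src (last f l)) = path_elt s f l.
Proof.
move=> ptck; elim/last_ind : l => [|l g _]; first exact: TCK_edge_src.
by rewrite last_rcons path_elt_rcons -cmulA TCK_edge_src.
Qed.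

(** The element s_l^* for the rest l of a cycle x l; the empty path is the vertex
at which the loop x is based. *)
Definition return_elt x l := if l is f :: l' then cadj (path_elt s f l') else p (rng x).

(** From s_x s_l = p_{r(x)} and s_l s_l^* = p_{s(x)} one gets
s_x = s_x s_l s_l^* = p_{r(x)} s_l^* = s_l^*. *)
Lemma cycle_edge x l : normalised_reduced_CK_family p s ->
  is_cycle (x :: l) -> no_entrance (x :: l) -> s x = return_elt x l.
Proof.
move=> [pck pn] cyc ne; have [ptck _] := pck; have := pn _ _ cyc ne.
case: cyc; case: l ne => [//|f l] ne pl closed _; rewrite path_elt_cons => sxy.
move: pl; rewrite /is_path /= => /andP[/eqP xf pl].
have [[pp _] _ _] := ptck.
rewrite -(TCK_edge_src x ptck) xf -(entryless_final pck ne _ pl); last first.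
  by move=> g gl; rewrite inE gl orbT.
rewrite cmulA sxy /return_elt -{2}(path_elt_src f l ptck) cadjM.
have -> : src (last f l) = rng x by rewrite closed.
by have [_ ->] := pp (rng x).
Qed.

(** By cycle_edge an edge in X is recovered from the edges off X. *)
Lemma generated_off_cutting_set (X : set (edge E)) :
  normalised_reduced_CK_family p s -> generating_family p s -> cutting_set X ->
  cgenerates (family_elts p s (~` X)).
Proof.
move=> pn pgen Xcut; apply/seteqP; split=> // a _.
have Da := cstar_gen_subalgebra (family_elts p s (~` X)).
have Dp v : cstar_gen (family_elts p s (~` X)) (p v).
  by apply: sub_cstar_gen; left; exists v.
have Ds e : ~ X e -> cstar_gen (family_elts p s (~` X)) (s e).
  by move=> Xe; apply: sub_cstar_gen; right; exists e.
suff : cstar_gen (family_elts p s setT) `<=` cstar_gen (family_elts p s (~` X)).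
  by apply; rewrite pgen.
apply: cstar_gen_min => // _ [[v _ <-]|[x _ <-]]; first exact: Dp.
have [Xx|] := pselect (X x); last exact: Ds.
have [l [cyc ne lX]] := cutting_set_cycle Xcut Xx.
rewrite (cycle_edge pn cyc ne); case: l lX {cyc ne} => [_|f l lX]; first exact: Dp.
have [_ _ _ _ DV] := Da; apply: DV; apply: (path_elt_gen Da) => g gl.
exact: Ds (lX _ gl).
Qed.

End OneFamily.

Section Phases.
Context {A : cStarAlgType R} (p : vertex E -> A).
Implicit Types (s : edge E -> A) (u : edge E -> R[i]).

Definition phased u s e := u e *: s e.

Lemma phased_final u s e : `|u e| = 1 ->
  phased u s e ** cadj (phased u s e) = s e ** cadj (s e).
Proof.
by move=> u1; rewrite cadjZ cmulZl cmulZr scalerA -normCK u1 expr1n scale1r.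
Qed.

Lemma TCK_phased u s : (forall e, `|u e| = 1) -> TCK_family p s ->
  TCK_family p (phased u s).
Proof.
move=> u1 [pp ss sF]; split=> // [e|v F Ff Fv].
  by rewrite cadjZ cmulZl cmulZr scalerA mulrC -normCK u1 expr1n scale1r.
rewrite (eq_fsbigr (fun e => s e ** cadj (s e))); first exact: sF.
by move=> e _; exact: phased_final.
Qed.

Lemma gen_phased_sub u s :
  cstar_gen (family_elts p (phased u s) setT) `<=` cstar_gen (family_elts p s setT).
Proof.
have Da := cstar_gen_subalgebra (family_elts p s setT).
have [_ _ DZ _ _] := Da.
apply: cstar_gen_min => // _ [[v _ <-]|[e _ <-]].
  by apply: sub_cstar_gen; left; exists v.
by apply: DZ; apply: sub_cstar_gen; right; exists e.
Qed.

Lemma gen_phased u s : (forall e, `|u e| = 1) ->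
  cstar_gen (family_elts p (phased u s) setT) = cstar_gen (family_elts p s setT).
Proof.
move=> u1; apply/seteqP; split; first exact: gen_phased_sub.
have {1}-> : s = phased (fun e => (u e)^-1) (phased u s).
  apply/funext => e; rewrite /phased scalerA mulVf ?scale1r//.
  by rewrite -normr_gt0 u1.
exact: gen_phased_sub.
Qed.

End Phases.

(** To test (b) for the new edges u S against a family q, t, apply (b) for S to
the family q, u^{-1} t: it generates the same subalgebra, and multiplying by u
turns psi (u^{-1} t) = S into psi t = u S. *)
Lemma satisfies_ab_phased (A : cStarAlgType R) (p : vertex E -> A)
    (s : edge E -> A) (u : edge E -> R[i]) : (forall e, `|u e| = 1) ->
  satisfies_ab p s -> satisfies_ab p (phased u s).
Proof.
move=> u1 [ptck pgen pa pb]; split=> //.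
- exact: TCK_phased.
- by rewrite /generating_family /cgenerates gen_phased.
move=> B q t qtck q0 X Xcut.
pose u' e := (u e)^-1.
have u0 e : u e != 0 by rewrite -normr_gt0 u1.
have u'1 e : `|u' e| = 1 by rewrite normfV u1 invr1.
have [k [psi [k1 psih psiq psit psix]]] := pb _ _ _ (TCK_phased u'1 qtck) q0 X Xcut.
rewrite (gen_phased _ _ u'1) in psih; have [_ psiZ _ _] := psih.
have psiE e : psi (t e) = u e *: psi (phased u' t e).
  rewrite psiZ; first by rewrite scalerA mulfV// scale1r.
  by apply: sub_cstar_gen; right; exists e.
exists k, psi; split=> //.
- by move=> e Xe; rewrite psiE psit.
- by move=> x Xx; rewrite psiE psix// /phased !scalerA mulrC.
Qed.

Lemma hom_sum (A B : cStarAlgType R) (D : set B) (f : B -> A) (J : choiceType)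
    (F : set J) (x : J -> B) :
  cstar_subalgebra D -> star_hom_on D f -> (forall j, D (x j)) ->
  finite_set F -> f (\sum_(j \in F) x j) = \sum_(j \in F) f (x j).
Proof.
move=> [_ [D0 DD] _ _ _] [fD fZ _ _] Dx Ffin; rewrite !fsbig_finite//=.
suff : forall r : seq J, D (\sum_(j <- r) x j) /\
    f (\sum_(j <- r) x j) = \sum_(j <- r) f (x j).
  by move=> h; have [] := h (finmap.enum_fset (fset_set F)).
elim=> [|j r [Dr fr]].
  by rewrite !big_nil; split=> //; rewrite -(scale0r (0 : B)) fZ// !scale0r.
by rewrite !big_cons; split; [exact: DD|rewrite fD// fr].
Qed.

(** Positivity is not transported along f, since f need not be defined off the
subalgebra; hence the image is assumed to be a Toeplitz-Cuntz-Krieger family. *)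
Lemma hom_normalised (A B : cStarAlgType R) (q : vertex E -> B) (t : edge E -> B)
    (f : B -> A) :
  normalised_reduced_CK_family q t ->
  star_hom_on (cstar_gen (family_elts q t setT)) f ->
  TCK_family (f \o q) (f \o t) ->
  normalised_reduced_CK_family (f \o q) (f \o t).
Proof.
move=> [[_ qck] qn] fh ptck; have [_ _ fM fV] := fh.
have Da := cstar_gen_subalgebra (family_elts q t setT).
have Dt e : cstar_gen (family_elts q t setT) (t e).
  by apply: sub_cstar_gen; right; exists e.
have [_ _ _ DM DV] := Da.
split; first split=> // v v0 vfin.
  rewrite /= qck// (hom_sum Da fh)//; last by move=> e; apply: DM => //; exact: DV.
  by apply: eq_fsbigr => e _ /=; rewrite fM ?fV//; exact: DV.
by move=> e l cyc ne; rewrite -(hom_path_elt _ _ Da fh)// qn.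
Qed.

(** Property (b), applied to the concrete family, exhibits the edges S up to
phases as the image of a normalised reduced family. *)
Lemma normalised_generators (A : cStarAlgType R) (P : vertex E -> A)
    (S : edge E -> A) : row_finite E -> satisfies_ab P S ->
  exists s : edge E -> A, normalised_reduced_CK_family P s /\ satisfies_ab P s.
Proof.
move=> hE ab; have [ptck _ _ pb] := ab.
have [X Xcut] := @exists_cutting_set E.
have qn := @ck_normalised R E hE; have [[qtck _] _] := qn.
have [k [psi [k1 psih psiq psit psix]]] :=
  pb _ _ _ qtck (@ck_proj_neq0 R E) X Xcut.
pose u e := if `[< X e >] then k e else 1.
have u1 e : `|u e| = 1.
  by rewrite /u; case: asboolP => [/k1//|_]; rewrite normr1.
have sE : psi \o (@ck_edge R E hE) = phased u S.
  apply/funext => e; rewrite /phased /u /=; case: asboolP => Xe.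
    by rewrite psix.
  by rewrite psit// scale1r.
have pE : psi \o (@ck_proj R E) = P by apply/funext => v; exact: psiq.
exists (phased u S); split; last exact: satisfies_ab_phased.
rewrite -sE -pE; apply: hom_normalised => //; rewrite sE pE.
exact: TCK_phased.
Qed.

(** For normalised families the scalars kappa of (b) disappear: on both sides the
edge in the cutting set is given by cycle_edge, hence f respects it. *)
Lemma normalised_hom (A B : cStarAlgType R) (p : vertex E -> A) (s : edge E -> A)
    (q : vertex E -> B) (t : edge E -> B) :
  normalised_reduced_CK_family p s -> property_b p s ->
  normalised_reduced_CK_family q t -> generating_family q t ->
  (forall v, q v <> 0) ->
  exists f : B -> A, [/\ star_hom_on setT f, forall v, f (q v) = p v &
                        forall e, f (t e) = s e].
Proof.
move=> pn pb qn qgen q0; have [[qtck _] _] := qn.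
have [X Xcut] := @exists_cutting_set E.
have [k [f [_ fh fq ft _]]] := pb _ _ _ qtck q0 X Xcut.
rewrite qgen in fh; exists f; split=> // x.
have [Xx|] := pselect (X x); last exact: ft.
have [l [cyc ne lX]] := cutting_set_cycle Xcut Xx.
rewrite (cycle_edge qn cyc ne) (cycle_edge pn cyc ne).
case: l lX {cyc ne} => [_|g l lX]; first exact: fq.
have [_ _ _ fV] := fh.
have Ta : cstar_subalgebra [set: B] by split=> //; exact: closedT.
rewrite /return_elt fV// (hom_path_elt _ _ Ta fh)//; congr cadj.
by apply: eq_path_elt => h hl; apply/ft/lX.
Qed.

End FamilyTheory.

Theorem theorem4p1 (R : realType) (E : digraph) (A : cStarAlgType R)
    (hE : row_finite E) (hA : is_Cstar_min E A) :
  (exists (p : vertex E -> A) (s : edge E -> A),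
     [/\ normalised_reduced_CK_family p s,
         generating_family p s,
         property_a p,
         property_b p s &
         forall X : set (edge E), cutting_set X ->
           cgenerates (family_elts p s (~` X))])
  /\
  (forall B : cStarAlgType R, is_Cstar_min E B -> cstar_isomorphic B A).
Proof.
have [P [S /(normalised_generators hE)[s [pn [ptck pgen pa pb]]]]] := hA.
split.
  exists P, s; split=> // X; exact: generated_off_cutting_set.
move=> B [Q [T /(normalised_generators hE)[t [qn [qtck qgen qa qb]]]]].
have [f [fh fq ft]] := normalised_hom pn pb qn qgen qa.
have [g [gh gp gs]] := normalised_hom qn qb pn pgen pa.
have comp (C D : cStarAlgType R) (a : C -> D) (b : D -> C) :
    star_hom_on setT a -> star_hom_on setT b -> star_hom_on setT (b \o a).
  move=> [aD aZ aM aV] [bD bZ bM bV]; split=> [x y _ _|c x _|x y _ _|x _] /=.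
  - by rewrite aD ?bD.
  - by rewrite aZ ?bZ.
  - by rewrite aM ?bM.
  - by rewrite aV ?bV.
exists f; split=> //; exists g.
- apply: (hom_eq_on_generators (comp _ _ _ _ fh gh) qgen).
  by move=> _ [[v _ <-]|[e _ <-]] /=; rewrite ?fq ?ft.
- apply: (hom_eq_on_generators (comp _ _ _ _ gh fh) pgen).
  by move=> _ [[v _ <-]|[e _ <-]] /=; rewrite ?gp ?gs.
Qed.
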